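(* Let $\mathcal{A}$ be an irreducible $TF_2$ arrangement of rank $r=r(\mathcal{A})\ge 3$. Then (a) $|\mathcal{A}|=r-\#L_2^{\mathrm{trip}}+\sum_{X\in L_2^{\mathrm{trip}}}(|\mathcal{A}_X|-1)$; (b) $|\mathcal{A}|\le 1+\sum_{X\in L_2^{\mathrm{trip}}}(|\mathcal{A}_X|-1)$; (c) $\#L_2^{\mathrm{trip}}\ge r-1$. Furthermore, the following are equivalent: (1) $\mathcal{A}$ is free; (2) $|\mathcal{A}|=1+\sum_{X\in L_2^{\mathrm{trip}}}(|\mathcal{A}_X|-1)$; (3) $\#L_2^{\mathrm{trip}}=r-1$; (4) $\mathcal{A}$ is supersolvable. In particular, for $TF_2$ arrangements, freeness is determined by the intersection lattice: if two $TF_2$ arrangements have isomorphic intersection lattices, then one is free if and only if the other is.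
   Context: Let $\mathbb{K}$ be a field, $V$ a finite-dimensional $\mathbb{K}$-vector space, $S=\mathrm{Sym}(V^* )$. An arrangement $\mathcal{A}$ in $V$ is a finite set of linear hyperplanes $H=\ker\alpha_H$ ($0\ne\alpha_H\in V^*$). $L=L(\mathcal{A})$ is the set of intersections of hyperplanes (including $V$), ordered by reverse inclusion and ranked by codimension; $L_k$ is the set of flats of rank $k$; $r(\mathcal{A})$ is the codimension of $T(\mathcal{A})=\bigcap_{H\in\mathcal{A}}H$; $\mathcal{A}_X=\{H\in\mathcal{A}:X\subseteq H\}$; $L_2^{\mathrm{trip}}$ is the set of $X\in L_2$ with $|\mathcal{A}_X|\ge3$. $\mathcal{A}$ is irreducible if it is not a product of arrangements in nonzero spaces (a factor may be empty, so irreducible implies essential, i.e. $r(\mathcal{A})=\dim V$). $\mathcal{A}$ is free if $D(\mathcal{A})=\{\theta\in\mathrm{Der}_{\mathbb{K}}(S):\theta(\alpha_H)\in\langle\alpha_H\rangle\ \forall H\}$ is a free $S$-module. Supersolvable: there is a filtration $\mathcal{A}_1\subset\cdots\subset\mathcal{A}_r=\mathcal{A}$ with $r(\mathcal{A}_i)=i$ for all $i$ and such that for $i\ge2$ and distinct $H,H'\in\mathcal{A}_i$ there is $H''\in\mathcal{A}_{i-1}$ with $H\cap H'\subset H''$. Formality: $R_0(\mathcal{A})=T(\mathcal{A})^*$ and for $1\le k\le r$, $R_k(\mathcal{A})=\ker\big(\pi_{k-1}:\bigoplus_{X\in L_{k-1}}R_{k-1}(\mathcal{A}_X)\to R_{k-1}(\mathcal{A})\big)$,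 where $\pi_k$ is the sum of the natural maps $R_k(\mathcal{A}_X)\to R_k(\mathcal{A})$ (restriction of functionals for $k=0$, inclusions induced on kernels by inclusion of summands for $k\ge1$). $\mathcal{A}$ is $2$-formal if $\pi_2$ is surjective, and $k$-formal ($k\ge3$) if it is $(k-1)$-formal and $\pi_k:\bigoplus_{X\in L_k}R_k(\mathcal{A}_X)\to R_k(\mathcal{A})$ is surjective (automatic for $k=r$). $\mathcal{A}$ is totally formal if $\mathcal{A}_X$ is $k$-formal for all $2\le k\le r(X)$ and all $X\in L$. The complex $\mathcal{S}^\bullet(\mathcal{A})$ has modules $\mathcal{S}^k(\mathcal{A})=\bigoplus_{X\in L_k}R_k(\mathcal{A}_X)^*\otimes_{\mathbb{K}}S$. $\mathcal{A}$ is $TF_2$ if it is totally formal and $\mathcal{S}^i(\mathcal{A})=0$ (i.e. $R_i(\mathcal{A}_X)=0$ for all $X\in L_i$) for all $i>2$. *)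

(* Defs.v *)
From HB Require Import structures.
From mathcomp Require Import all_boot all_order all_algebra finmap mpoly.

Set Implicit Arguments.
Unset Strict Implicit.
Unset Printing Implicit Defensive.

Import GRing.Theory.
Local Open Scope ring_scope.

Section Arrangements.
Variables (K : fieldType) (V : vectType K).

Definition dual : vectType K := 'Hom(V, K^o).

Definition arrangement (A : {fset {vspace V}}) : Prop :=
  forall H, H \in A -> exists2 alpha : dual, alpha != 0 & H = lker alpha.

Definition codim (U : {vspace V}) : nat := \dim {:V} - \dim U.

(* T(A); the empty intersection is V. *)
Definition center (A : {fset {vspace V}}) : {vspace V} :=
  (\bigcap_(H <- A) H)%VS.

Definition rank (A : {fset {vspace V}}) : nat := codim (center A).

(* L(A); its order is reverse inclusion and its rank function is [codim]. *)
Definition lattice (A : {fset {vspace V}}) : {fset {vspace V}} :=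
  [fset center B | B in fpowerset A]%fset.

Definition flats (k : nat) (A : {fset {vspace V}}) : {fset {vspace V}} :=
  [fset X in lattice A | codim X == k]%fset.

Definition localization (A : {fset {vspace V}}) (X : {vspace V}) :
  {fset {vspace V}} := [fset H in A | (X <= H)%VS]%fset.

Definition triple_flats (A : {fset {vspace V}}) : {fset {vspace V}} :=
  [fset X in flats 2 A | (3 <= #|` localization A X|)%N]%fset.

Definition supersolvable (A : {fset {vspace V}}) : Prop :=
  exists F : nat -> {fset {vspace V}},
    [/\ F (rank A) = A,
        forall i, (1 <= i < rank A)%N -> (F i `<=` F i.+1)%fset,
        forall i, (1 <= i <= rank A)%N -> rank (F i) = i
      & forall i, (2 <= i <= rank A)%N ->
          forall H H', H \in F i -> H' \in F i -> H != H' ->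
          exists2 H'', H'' \in F i.-1 & (H :&: H' <= H'')%VS].

(* Sym(V^* ) is the polynomial ring on the basis of V^* dual to the basis
   [vbasis {:V}] of V; [linear_form] is the inclusion of V^* in degree one. *)
Definition Sym := {mpoly K[\dim {:V}]}.

Definition linear_form (alpha : dual) : Sym :=
  \sum_(i < \dim {:V}) (alpha (tnth (vbasis {:V}) i) : K) *: 'X_i.

Definition derivation (theta : Sym -> Sym) : Prop :=
  linear theta /\
  forall p q, theta (p * q) = theta p * q + p * theta q.

(* The forms with kernel H are the nonzero multiples of one another, so that
   quantifying over all of them is the same as choosing alpha_H. *)
Definition log_derivation (A : {fset {vspace V}}) (theta : Sym -> Sym) : Prop :=
  derivation theta /\
  forall alpha : dual, lker alpha \in A ->
    exists q, theta (linear_form alpha) = q * linear_form alpha.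

(* D(A) has a basis.  Finite bases suffice, D(A) being finitely generated: it
   is a submodule of the noetherian module of all derivations. *)
Definition free_arrangement (A : {fset {vspace V}}) : Prop :=
  exists (m : nat) (b : 'I_m -> Sym -> Sym),
    (forall i, log_derivation A (b i)) /\
    (forall theta, log_derivation A theta ->
       exists! c : {ffun 'I_m -> Sym},
         forall p, theta p = \sum_(i < m) c i * b i p).

End Arrangements.

Section Irreducible.
Variables (K : fieldType) (V : vectType K).

(* The product arrangement in the internal direct sum of V1 and V2. *)
Definition product_arrangement (V1 V2 : {vspace V})
    (A1 : {fset {vspace subvs_of V1}}) (A2 : {fset {vspace subvs_of V2}}) :
    {fset {vspace V}} :=
  ([fset (linfun vsval @: H + V2)%VS | H in A1] `|`
   [fset (V1 + linfun vsval @: H)%VS | H in A2])%fset.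

Definition irreducible (A : {fset {vspace V}}) : Prop :=
  ~ exists (V1 V2 : {vspace V})
           (A1 : {fset {vspace subvs_of V1}})
           (A2 : {fset {vspace subvs_of V2}}),
    [/\ V1 != 0%VS /\ V2 != 0%VS,
        (V1 + V2)%VS = {:V}%VS /\ (V1 :&: V2)%VS = 0%VS,
        arrangement A1, arrangement A2
      & A = product_arrangement A1 A2].

End Irreducible.

Section FamilyMaps.
Variables (K : fieldType) (I : finType) (E : vectType K).

Definition fam_sum_fun (f : {ffun I -> E}) : E := \sum_i f i.

Fact fam_sum_is_linear : linear fam_sum_fun.
Proof.
move=> a f g; rewrite /fam_sum_fun scaler_sumr -big_split /=.
by apply: eq_bigr => i _; rewrite !ffunE.
Qed.
HB.instance Definition _ :=
  GRing.isLinear.Build K {ffun I -> E} E _ fam_sum_fun fam_sum_is_linear.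

Definition fam_sum : 'Hom({ffun I -> E}, E) := linfun fam_sum_fun.

Definition fam_in_fun (i : I) (v : E) : {ffun I -> E} :=
  [ffun j => if j == i then v else 0].

Fact fam_in_is_linear i : linear (fam_in_fun i).
Proof.
move=> a u v; apply/ffunP => j; rewrite !ffunE.
by case: eqP; rewrite // scaler0 addr0.
Qed.
HB.instance Definition _ i :=
  GRing.isLinear.Build K E {ffun I -> E} _ (fam_in_fun i) (fam_in_is_linear i).

Definition fam_in (i : I) : 'Hom(E, {ffun I -> E}) := linfun (fam_in_fun i).

End FamilyMaps.

Section RelationSpaces.
Variables (K : fieldType) (V : vectType K).

(* Restriction of functionals from V to U.  For U = T(B) this is the map
   pi_0 : R_0(V) -> R_0(B): L_0(B) = {V}, no hyperplane contains V, and so the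
   only summand of the source of pi_0 is the dual of the center V of the empty
   arrangement. *)
Definition restrict_fun (U : {vspace V}) (alpha : dual V) : dual (subvs_of U) :=
  (alpha \o linfun vsval)%VF.

Fact restrict_is_linear U : linear (restrict_fun U).
Proof. by move=> a f g; rewrite /restrict_fun comp_lfunDl comp_lfunZl. Qed.
HB.instance Definition _ U :=
  GRing.isLinear.Build K (dual V) (dual (subvs_of U)) _ (restrict_fun U)
    (restrict_is_linear U).

Definition restrict (U : {vspace V}) : 'Hom(dual V, dual (subvs_of U)) :=
  linfun (restrict_fun U).

(* F is a finite set of subspaces containing all the flats in play; below it
   is L(A), and the arrangements B are localizations of A.  A direct sum over
   L_k(B) is realized as the space of families indexed by F that vanish off
   L_k(B).  All the spaces R_{k+1}(B) then lie in one space [ambient k], and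
   the natural maps R_{k+1}(B_X) -> R_{k+1}(B) are inclusions. *)
Variable F : {fset {vspace V}}.

Fixpoint ambient (k : nat) : vectType K :=
  if k is k'.+1 then {ffun F -> ambient k'} else dual V.

(* The direct sum over X in L_k(B) of the subspaces W X, inside the families. *)
Definition flat_sum (E : vectType K) (k : nat) (B : {fset {vspace V}})
    (W : {vspace V} -> {vspace E}) : {vspace {ffun F -> E}} :=
  (\sum_(X : F | val X \in flats k B) (fam_in E X @: W (val X)))%VS.

(* [relS k B] is R_{k+1}(B). *)
Fixpoint relS (k : nat) (B : {fset {vspace V}}) : {vspace ambient k} :=
  match k return {vspace ambient k} with
  | 0 => lker (restrict (center B))
  | k'.+1 => (lker (fam_sum F (ambient k')) :&:
              flat_sum k'.+1 B (fun X => relS k' (localization B X)))%VS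
  end.

(* [pi_surjective k B]: pi_{k+1} maps onto R_{k+1}(B). *)
Definition pi_surjective (k : nat) (B : {fset {vspace V}}) : Prop :=
  (fam_sum F (ambient k) @:
     flat_sum k.+1 B (fun X => relS k (localization B X)))%VS = relS k B.

(* [formal k B]: B is k-formal. *)
Inductive formal (B : {fset {vspace V}}) : nat -> Prop :=
| formal_two : pi_surjective 1 B -> formal B 2
| formal_succ k :
    (2 <= k)%N -> formal B k -> pi_surjective k B -> formal B k.+1.

End RelationSpaces.

Section TF2.
Variables (K : fieldType) (V : vectType K).

Definition totally_formal (A : {fset {vspace V}}) : Prop :=
  forall X, X \in lattice A ->
  forall k, (2 <= k <= codim X)%N -> formal (lattice A) (localization A X) k.

Definition TF2 (A : {fset {vspace V}}) : Prop :=
  totally_formal A /\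
  forall i, (2 < i)%N -> forall X, X \in flats i A ->
    relS (lattice A) i.-1 (localization A X) = 0%VS.

End TF2.

Definition isomorphic_lattices (K : fieldType) (V V' : vectType K)
    (A : {fset {vspace V}}) (A' : {fset {vspace V'}}) : Prop :=
  exists f : lattice A -> lattice A',
    bijective f /\
    forall X Y, (val Y <= val X)%VS = (val (f Y) <= val (f X))%VS.

(* Main.v *)
Require Import Defs.
From HB Require Import structures.
From mathcomp Require Import all_boot all_order all_algebra finmap mpoly.
From mathcomp Require Import ring zify.

Set Implicit Arguments.
Unset Strict Implicit.
Unset Printing Implicit Defensive.

Import GRing.Theory.
Local Open Scope ring_scope.

(** The forms of an arrangement A are a finite family of pairwise independent
    vectors of V^*, the points; the flats X of rank 2 with |A_X| >= 3 are the
    lines with at least three points.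

    By 2-formality every linear relation among the forms is a sum of relations
    supported on lines.  Since R_3(A) is the image of a sum of spaces R_3(A_X)
    that vanish, it is zero as well, that is, such a sum is direct
    ([TF2_decompose]).  A line with m points carries m - 2 independent relations,
    and all relations have dimension |A| - r; this is the formula for |A|
    ([card_points]).

    For an irreducible arrangement the lines connect all points
    ([irreducible_connected]): otherwise the relations split, and with them A.
    Consider the linear map from the functions on the points to the direct sum,
    over the lines, of the functions on the line modulo constants.  Its kernel
    is then the line of constants, so that |A| - 1 is at most the sum of the
    |A_X| - 1, with equality if and only if the map is surjective.  This gives
    both inequalities.  Surjectivity says that for each line X and each h in X
    some function is constant on all other lines and is, on X, the indicator of
    h up to a constant ([acyclic], [acyclic_card]): the lines form a tree.

    Freeness is equivalent to this condition.  If it holds, a basis of D(A) can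
    be written down ([acyclic_log_free]): for each line the derivation of the
    corresponding arrangement of rank 2 that is not the Euler derivation,
    extended to all points by means of these functions; for each connected
    component the Euler derivation of the component; and the derivations that
    kill all forms. Conversely, up to the latter D(A) is the kernel of a map
    between free modules, whose cokernel C has projective dimension at most 2
    when D(A) is free, so that C has no associated prime of height 3 or more.
    The obstruction to the existence of the function attached to X and h is an
    element of C that vanishes at the generic points of all flats of rank at
    most 2, as products of forms show; it is therefore zero ([free_acyclic]).
    The argument is carried out with elements: [solvable_three] replaces the
    bound on the associated primes, and the forms that divide a product
    annihilating the obstruction are removed one at a time.

    The condition only involves collinearity of points, which can be read off
    from the lattice of flats ([coll_lattice], [acyclic_isomorphic]).

    It remains to compare with supersolvability.  If there are r - 1 lines, adding
    connected lines one after the other to a point gives the filtration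
    ([grown_chain]).  Conversely, at each level of a filtration the relations on
    the lines that join one new point to the other new points suffice to generate
    all relations, and these lines coincide; since the lines carry independent
    relations, there are at most r - 1 of them ([chain_trips]). *)

(** * Relations and lines of a family of vectors *)

Section Configuration.
Variables (K : fieldType) (E : vectType K) (T : finType) (al : T -> E).

Definition coefs : vectType K := {ffun T -> K^o}.

Definition comb_fun (c : coefs) : E := \sum_t (c t : K) *: al t.

Fact comb_is_linear : linear comb_fun.
Proof.
move=> k c d; rewrite /comb_fun scaler_sumr -big_split /=.
by apply: eq_bigr => t _; rewrite !ffunE scalerDl scalerA.
Qed.
HB.instance Definition _ :=
  GRing.isLinear.Build K coefs E _ comb_fun comb_is_linear.

Definition comb : 'Hom(coefs, E) := linfun comb_fun.

Lemma combE c : comb c = \sum_t (c t : K) *: al t.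
Proof. by rewrite lfunE. Qed.

Definition delta (s : T) : coefs := [ffun t => (t == s)%:R].

Lemma sum_delta (M : lmodType K) (F : T -> M) s :
  \sum_t (delta s t : K) *: F t = F s.
Proof.
rewrite (bigD1 s) //= ffunE eqxx scale1r big1 ?addr0 // => t ts.
by rewrite ffunE (negPf ts) scale0r.
Qed.

Lemma comb_delta s : comb (delta s) = al s.
Proof. by rewrite combE sum_delta. Qed.

Lemma coefsE (c : coefs) : c = \sum_t (c t : K) *: delta t.
Proof.
apply/ffunP => s; rewrite sum_ffunE (bigD1 s) //= !ffunE eqxx big1 ?addr0.
  by rewrite /GRing.scale /= mulr1.
by move=> t ts; rewrite !ffunE eq_sym (negPf ts) /GRing.scale /= mulr0.
Qed.

(** The values of a linear map on the vectors can be prescribed as soon as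
    they respect the relations: the map factors through the coefficients. *)
Lemma linear_extension (M : lmodType K) (F : T -> M) :
  (forall c, comb c = 0 -> \sum_t (c t : K) *: F t = 0) ->
  exists2 tau : E -> M, linear tau & forall t, tau (al t) = F t.
Proof.
move=> relF; pose sF (c : coefs) := \sum_t (c t : K) *: F t.
have sF_lin : linear sF.
  move=> k c d; rewrite /sF scaler_sumr -big_split /=.
  by apply: eq_bigr => t _; rewrite !ffunE scalerDl scalerA.
exists (fun e => sF ((comb^-1)%VF e)).
  by move=> k c d; rewrite linearP sF_lin.
move=> t; rewrite -(sum_delta F t); apply/eqP; rewrite -subr_eq0.
rewrite -sumrB (eq_bigr (fun s =>
  (((comb^-1)%VF (al t) - delta t : coefs) s : K) *: F s)).
  rewrite relF // linearB /= limg_lfunVK ?comb_delta ?subrr //.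
  by rewrite -comb_delta memv_img ?memvf.
by move=> s _; rewrite !ffunE scalerBl.
Qed.

Definition supported (L : {set T}) : {vspace coefs} :=
  (\sum_(t in L) <[delta t]>)%VS.

Lemma supportedP (L : {set T}) (c : coefs) :
  reflect (forall t, t \notin L -> c t = 0) (c \in supported L).
Proof.
apply: (iffP idP) => [/memv_sumP[v vP ->] t tL | cL].
  rewrite sum_ffunE big1 // => s sL; have /vlineP[k ->] := vP s sL.
  by rewrite !ffunE; case: eqP tL sL => [->|_ _ _]; rewrite ?scaler0 // => /negP.
rewrite [c]coefsE (bigID (mem L)) /= [X in _ + X]big1 ?addr0.
  by apply: memv_sumr => t tL; rewrite memvZ ?memv_line.
by move=> t tL; rewrite cL // scale0r.
Qed.

Lemma dim_supported L : \dim (supported L) = #|L|.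
Proof.
have dir : directv (\sum_(t in L) <[delta t]>).
  apply/directv_sum_independent => us usP us0 t tL.
  have /vlineP[k kE] := usP t tL.
  move/ffunP/(_ t): us0; rewrite sum_ffunE (bigD1 t) //= big1 ?addr0.
    rewrite kE !ffunE eqxx /GRing.scale /= mulr1 => ->.
    by rewrite -[RHS](scale0r (delta t)).
  move=> s /andP[sL st]; have /vlineP[l ->] := usP s sL.
  by rewrite !ffunE eq_sym (negPf st) scaler0.
rewrite /supported (directvP dir) /= -sum1_card; apply: eq_bigr => t _.
rewrite dim_vline; case: eqP => // /ffunP/(_ t).
by rewrite !ffunE eqxx => /eqP; rewrite oner_eq0.
Qed.

Definition spanned (S : {set T}) : {vspace E} := (\sum_(t in S) <[al t]>)%VS.

Lemma mem_spanned (S : {set T}) t : t \in S -> al t \in spanned S.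
Proof. by move=> tS; apply: (subvP (sumv_sup t tS (subvv _))); apply: memv_line. Qed.

Lemma spannedP (S : {set T}) (U : {vspace E}) :
  reflect (forall t, t \in S -> al t \in U) (spanned S <= U)%VS.
Proof. exact: subv_sumP. Qed.

Lemma spannedS (S S' : {set T}) : S \subset S' -> (spanned S <= spanned S')%VS.
Proof. by move=> /subsetP sub; apply/spannedP => t /sub; apply: mem_spanned. Qed.

Lemma limg_supported L : (comb @: supported L)%VS = spanned L.
Proof.
rewrite /supported limg_sum /spanned; apply: eq_bigr => t _.
by rewrite limg_line comb_delta.
Qed.

Lemma spanned_setT : limg comb = spanned setT.
Proof.
rewrite -limg_supported; congr (_ @: _)%VS; apply/esym/vspaceP => c.
by rewrite memvf; apply/supportedP => t; rewrite inE.
Qed.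

Lemma spannedU S S' : spanned (S :|: S') = (spanned S + spanned S')%VS.
Proof.
apply/eqP; rewrite eqEsubv subv_add !spannedS ?subsetUl ?subsetUr //.
rewrite !andbT; apply/spannedP => t; rewrite inE => /orP[] /mem_spanned.
  exact/subvP/addvSl.
exact/subvP/addvSr.
Qed.

Definition relations (L : {set T}) : {vspace coefs} :=
  (supported L :&: lker comb)%VS.

Lemma relationsP (L : {set T}) (c : coefs) :
  reflect ((forall t, t \notin L -> c t = 0) /\ comb c = 0)
          (c \in relations L).
Proof.
rewrite memv_cap memv_ker; apply: (iffP andP).
  by case=> /supportedP ? /eqP.
by case=> ? /eqP ?; split=> //; apply/supportedP.
Qed.

Lemma dim_relations L : (\dim (relations L) + \dim (spanned L))%N = #|L|.
Proof. by rewrite -limg_supported limg_ker_dim dim_supported. Qed.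

Definition plane a b : {vspace E} := (<[al a]> + <[al b]>)%VS.

Lemma planeP a b v :
  reflect (exists k l, v = k *: al a + l *: al b) (v \in plane a b).
Proof.
apply: (iffP idP) => [/memv_addP[_ /vlineP[k ->] [_ /vlineP[l ->] ->]] | ].
  by exists k, l.
by case=> k [l ->]; rewrite memv_add ?memvZ ?memv_line.
Qed.

Definition collinear a b c : bool := al c \in plane a b.

Definition line a b : {set T} := [set c | collinear a b c].

(** For the forms of an arrangement these are the flats of rank 2 that lie on at
    least three hyperplanes, each given by its hyperplanes.  A line with two
    points carries no relation. *)
Definition trips : {set {set T}} :=
  [set L : {set T} |
    [exists a, exists b, (a != b) && (L == line a b)] && (2 < #|L|)%N].

Definition simple : Prop :=
  (forall a, al a != 0) /\ (forall a b, al b \in <[al a]>%VS -> b = a).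

Hypothesis als : simple.
Let al_neq0 := als.1.
Let al_inj := als.2.

Lemma coll_l a b : collinear a b a.
Proof. by apply/planeP; exists 1, 0; rewrite scale1r scale0r addr0. Qed.

Lemma coll_r a b : collinear a b b.
Proof. by apply/planeP; exists 0, 1; rewrite scale1r scale0r add0r. Qed.

Lemma dim_plane a b : a != b -> \dim (plane a b) = 2%N.
Proof.
move=> ab; rewrite dimv_disjoint_sum ?dim_vline ?al_neq0 //.
apply/eqP; rewrite -subv0; apply/subvP => v.
rewrite memv_cap memv0 => /andP[/vlineP[k ->] /vlineP[l kl]].
have [->|k0] := eqVneq k 0; first by rewrite scale0r.
case/eqP: ab; apply: al_inj; apply/vlineP; exists (k^-1 * l).
by rewrite -scalerA -kl scalerA mulVf // scale1r.
Qed.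

Lemma eq_plane a b c d : c != d -> collinear a b c -> collinear a b d ->
  plane c d = plane a b.
Proof.
move=> cd abc abd; apply/eqP; rewrite eqEdim; apply/andP; split.
  by rewrite subv_add -!memvE; apply/andP.
by rewrite (dim_plane cd) (leq_trans (dimv_add_leqif _ _)) ?dim_vline //
  (leq_add (leq_b1 _) (leq_b1 _)).
Qed.

Lemma line_eq a b c d : c != d -> c \in line a b -> d \in line a b ->
  line c d = line a b.
Proof.
rewrite !inE => cd abc abd; apply/setP => t.
by rewrite !inE /collinear (eq_plane cd abc abd).
Qed.

Lemma line_l a b : a \in line a b. Proof. by rewrite inE coll_l. Qed.
Lemma line_r a b : b \in line a b. Proof. by rewrite inE coll_r. Qed.

Lemma collC a b c : collinear a b c = collinear b a c.
Proof. by rewrite /collinear /plane addvC. Qed.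

Lemma tripsP L :
  reflect (exists a b, [/\ a != b, L = line a b & 2 < #|L|]%N) (L \in trips).
Proof.
rewrite inE; apply: (iffP andP).
  by case=> /existsP[a /existsP[b /andP[ab /eqP LE]]] L3; exists a, b.
case=> a [b [ab LE L3]]; split=> //; apply/existsP; exists a; apply/existsP.
by exists b; rewrite ab LE eqxx.
Qed.

Lemma trip_card L : L \in trips -> (2 < #|L|)%N.
Proof. by case/tripsP => a [b []]. Qed.

Lemma trip_line L a b : L \in trips -> a != b -> a \in L -> b \in L ->
  L = line a b.
Proof. by move=> /tripsP[c [d [cd -> _]]] ab aL bL; rewrite (line_eq ab aL bL). Qed.

Lemma trip_eq L M a b : L \in trips -> M \in trips -> a != b ->
  a \in L -> b \in L -> a \in M -> b \in M -> L = M.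
Proof.
by move=> Lt Mt ab aL bL aM bM; rewrite (trip_line Lt ab) // (trip_line Mt ab).
Qed.

Lemma trip_third L a b : L \in trips ->
  exists2 c, c \in L & (c != a) && (c != b).
Proof.
move=> Lt; have: (0 < #|L :\ a :\ b|)%N.
  have := trip_card Lt; rewrite (cardsD1 a) (cardsD1 b (L :\ a)).
  by case: (a \in L); case: (b \in L :\ a) => //=; rewrite ?add0n ?add1n;
    case: #|_| => //.
by case/card_gt0P => c; rewrite !inE => /and3P[cb ca cL]; exists c; rewrite ?ca.
Qed.

Lemma line_spanned a b : a != b -> spanned (line a b) = plane a b.
Proof.
move=> ab; apply/eqP; rewrite eqEsubv; apply/andP; split.
  by apply/spannedP => t; rewrite inE.
by rewrite subv_add -!memvE !mem_spanned ?line_l ?line_r.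
Qed.

Lemma dim_trip_relations L : L \in trips -> \dim (relations L) = (#|L| - 2)%N.
Proof.
case/tripsP => a [b [ab -> _]].
by rewrite -(dim_relations (line a b)) line_spanned // dim_plane // addnK.
Qed.

Lemma coll_coefs a b c : c != a -> c != b -> collinear a b c ->
  exists k l, [/\ k != 0, l != 0 & al c = k *: al a + l *: al b].
Proof.
move=> ca cb /planeP[k [l clE]]; exists k, l; split=> //.
  apply: contra_neq cb => k0; apply: al_inj; apply/vlineP; exists l.
  by rewrite clE k0 scale0r add0r.
apply: contra_neq ca => l0; apply: al_inj; apply/vlineP; exists k.
by rewrite clE l0 scale0r addr0.
Qed.

(** This is what the homological hypothesis on an arrangement amounts to: in
    terms of the spaces R_k, the first half is the surjectivity of pi_2 onto R_2
    and the second half its injectivity. *)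
Definition lines_decompose : Prop :=
  (lker comb <= \sum_(L in trips) relations L)%VS /\
  directv (\sum_(L in trips) relations L).

Hypothesis decomp : lines_decompose.

Lemma relations_setT : (\sum_(L in trips) relations L)%VS = lker comb.
Proof.
apply/eqP; rewrite eqEsubv decomp.1 andbT.
by apply/subv_sumP => L _; apply: capvSr.
Qed.

(** The relations have dimension |T| minus the rank, and a line with m points
    contributes m - 2 to them. *)
Lemma card_points :
  #|T| = (\dim (spanned setT) + \sum_(L in trips) (#|L| - 2))%N.
Proof.
rewrite -cardsT -(dim_relations setT) addnC; congr (_ + _)%N.
have -> : relations setT = lker comb.
  apply/capv_idPr/subvP => c _; apply/supportedP => t.
  by rewrite inE.
rewrite -relations_setT (directvP decomp.2) /=.
by apply: eq_bigr => L /dim_trip_relations.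
Qed.

End Configuration.

(** * Acyclic configurations of lines *)

(** A form of the statement that the lines make up a forest: removing the line
    through a and b separates the points of that line from each other, and g is
    the indicator of the branch at h.  Linear algebra over K replaces
    connectivity here, so that no component has to be chosen.  Only collinearity
    enters, which is what makes the condition depend on the lattice alone. *)
Definition acyclic (K : fieldType) (T : finType) (cl : T -> T -> T -> bool) :=
  forall a b h, a != b -> cl a b h ->
  exists g : T -> K, forall s t w, s != t -> w != s -> w != t -> cl s t w ->
    if cl a b s && cl a b t then g s - (s == h)%:R = g t - (t == h)%:R
    else g s = g t.

Lemma dim_coefs (K : fieldType) (T : finType) : \dim {:coefs K T} = #|T|.
Proof.
rewrite -cardsT -(dim_supported K); congr (\dim _); apply/esym/vspaceP => c.
by rewrite memvf; apply/supportedP => t; rewrite inE.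
Qed.

Section Acyclicity.
Variables (K : fieldType) (E : vectType K) (T : finType) (al : T -> E).
Hypothesis als : simple al.
Local Notation trips := (trips al).

Definition constant_on (S : eqType) (L : {set T}) (g : T -> S) :=
  forall s t, s \in L -> t \in L -> g s = g t.

Lemma acyclicP :
  acyclic K (collinear al) <->
  forall L h, L \in trips -> h \in L -> exists g : T -> K,
    (forall M, M \in trips -> M != L -> constant_on M g) /\
    constant_on L (fun s => g s - (s == h)%:R).
Proof.
split=> [acyc L h Lt | ind a b h ab abh].
  have [a [b [ab LE L3]]] := tripsP _ _ Lt; rewrite LE inE => abh.
  have [g gP] := acyc a b h ab abh; exists g.
  split=> [M Mt ML s t sM tM | s t]; have [->//|st] := eqVneq s t.
    have [w wM /andP[ws wt]] := trip_third s t Mt.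
    have := gP s t w st ws wt; move: (wM).
    rewrite (trip_line als Mt st) // inE => -> /(_ isT).
    case: ifP => // /andP[abs abt] _; case/eqP: ML.
    by rewrite -LE; apply: (trip_eq als Mt Lt st); rewrite // LE inE.
  move=> sL tL; have sL' : s \in L by rewrite LE.
  have tL' : t \in L by rewrite LE.
  have [w wL /andP[ws wt]] := trip_third s t Lt.
  have := gP s t w st ws wt; move: (wL).
  rewrite (trip_line als Lt st) // inE => -> /(_ isT).
  by move: sL tL; rewrite !inE => -> ->.
have [Lt|nLt] := boolP (line al a b \in trips); last first.
  exists (fun=> 0) => s t w st ws wt stw; case: ifP => // /andP[abs abt].
  case/negP: nLt; apply/tripsP; exists a, b; split=> //.
  rewrite (cardsD1 s) (cardsD1 t) (cardsD1 w) !inE abs abt eq_sym st ws wt.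
  suff -> : collinear al a b w by [].
  by rewrite /collinear -(eq_plane als st abs abt).
have hL : h \in line al a b by rewrite inE.
have [g [gM gL]] := ind _ h Lt hL; exists g => s t w st ws wt stw.
case: ifP => [/andP[abs abt]|nst]; first by apply: gL; rewrite inE.
have Mt : line al s t \in trips.
  apply/tripsP; exists s, t; split=> //.
  by rewrite (cardsD1 s) (cardsD1 t) (cardsD1 w) !inE coll_l coll_r eq_sym st ws wt stw.
apply: (gM _ Mt); rewrite ?line_l ?line_r //.
apply: contraFN nst => /eqP LE.
by have:= line_l al s t; have:= line_r al s t; rewrite LE !inE => -> ->.
Qed.

Definition linked s t : bool := [exists L in trips, (s \in L) && (t \in L)].

Lemma constant_connect (S : eqType) (g : T -> S) s t :
  (forall L, L \in trips -> constant_on L g) -> connect linked s t -> g s = g t.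
Proof.
move=> gL /connectP[p]; elim: p s => [|u p IH] s /= => [_ -> //|].
case/andP=> /existsP[L /and3P[Lt sL uL]] pth lst.
by rewrite (gL L Lt s u sL uL); apply: IH.
Qed.

Definition base (L : {set T}) : option T := [pick t in L].

Definition base_coef (c : coefs K T) (L : {set T}) : K :=
  if base L is Some b then c b else 0.

(** The coordinates of the direct sum, over the lines, of the functions on the
    points of the line modulo constants: one for each point other than a chosen
    base point. *)
Definition difference :=
  {x : {set T} * T | [&& x.1 \in trips, x.2 \in x.1 & Some x.2 != base x.1]}.

Definition differences_fun (c : coefs K T) : coefs K difference :=
  [ffun x => c (val x).2 - base_coef c (val x).1].

Fact differences_is_linear : linear differences_fun.
Proof.
move=> k c d; apply/ffunP => x; rewrite !ffunE /base_coef.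
case: base => [b|]; rewrite ?ffunE; last by rewrite !subr0.
by rewrite scalerBr opprD addrACA.
Qed.
HB.instance Definition _ :=
  GRing.isLinear.Build K (coefs K T) (coefs K difference) _
    differences_fun differences_is_linear.

Definition differences := linfun differences_fun.

Lemma card_difference : #|{: difference}| = (\sum_(L in trips) (#|L| - 1))%N.
Proof.
rewrite card_sig -sum1_card.
rewrite (eq_bigl (fun x : {set T} * T => (x.1 \in trips) &&
   ((x.2 \in x.1) && (Some x.2 != base x.1)))) //.
rewrite -(pair_big_dep (mem trips) (fun (L : {set T}) t =>
   (t \in L) && (Some t != base L)) (fun _ _ => 1%N)) /=.
apply: eq_bigr => L Lt; rewrite /base; case: pickP => [b bL | L0]; last first.
  by have := trip_card Lt; rewrite eq_card0 ?ltnn // => t; apply: L0.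
rewrite (cardsD1 b) bL addKn -sum1_card; apply: eq_bigl => t.
by rewrite !inE andbC.
Qed.

Lemma differences_ker (c : coefs K T) :
  c \in lker differences <-> forall L, L \in trips -> constant_on L c.
Proof.
rewrite memv_ker lfunE; split=> [/eqP/ffunP c0 L Lt | cL].
  suff h s : s \in L -> c s = base_coef c L by move=> s t /h-> /h->.
  move=> sL; have [sb|sb] := eqVneq (Some s) (base L).
    by rewrite /base_coef -sb.
  have sP : [&& L \in trips, s \in L & Some s != base L] by rewrite Lt sL.
  by apply/eqP; rewrite -subr_eq0; have := c0 (exist _ (L, s) sP); rewrite !ffunE => ->.
apply/eqP/ffunP => -[[L s] /= xP]; have /and3P[Lt sL sb] := xP; rewrite !ffunE /=.
rewrite /base_coef /base; case: pickP => [b bL|/(_ s)]; last by rewrite sL.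
by rewrite (cL L Lt s b) // subrr.
Qed.

Hypothesis conn : forall s t, connect linked s t.
Variable s0 : T.

Lemma dim_differences_ker : \dim (lker differences) = 1%N.
Proof.
have -> : lker differences = <[[ffun=> 1] : coefs K T]>%VS.
  apply/vspaceP => c; apply/idP/vlineP => [/differences_ker cL | [k ->]].
    exists (c s0); apply/ffunP => t; rewrite !ffunE /GRing.scale /= mulr1.
    exact: constant_connect cL (conn t s0).
  by apply/differences_ker => L Lt s t _ _; rewrite !ffunE.
rewrite dim_vline; case: eqP => // /ffunP/(_ s0).
by rewrite !ffunE => /eqP; rewrite oner_eq0.
Qed.

(** When the lines connect all points, only the constants are constant on every
    line; all further counting is the rank formula for this one map. *)
Lemma differences_rank : #|T| = (1 + \dim (limg differences))%N.
Proof.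
by rewrite -dim_differences_ker -(dim_coefs K) -(limg_ker_dim differences) capfv.
Qed.

Lemma card_points_le : (#|T| <= 1 + \sum_(L in trips) (#|L| - 1))%N.
Proof.
by rewrite differences_rank leq_add2l -card_difference -(dim_coefs K) dimvS ?subvf.
Qed.

(** Acyclicity says that the basis vectors of the target of [differences] are
    values of this map, hence that it is surjective. *)
Lemma acyclic_card :
  acyclic K (collinear al) <-> #|T| = (1 + \sum_(L in trips) (#|L| - 1))%N.
Proof.
rewrite acyclicP differences_rank -card_difference -(dim_coefs K).
split=> [ind | /addnI dimE]; last first.
  have imE : limg differences = fullv.
    by apply/eqP; rewrite eqEdim subvf dimE leqnn.
  move=> L h Lt hL; pose d : coefs K difference :=
    [ffun x => if (val x).1 == L
       then ((val x).2 == h)%:R - (Some h == base L)%:R else 0].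
  have /memv_imgP[g _ dE] : d \in limg differences by rewrite imE memvf.
  exists g; have dxE M s : M \in trips -> s \in M ->
     g s - base_coef g M = if M == L then (s == h)%:R - (Some h == base L)%:R else 0.
    move=> Mt sM; have [sb|sb] := eqVneq (Some s) (base M).
      rewrite /base_coef -sb subrr; case: eqP => // ML.
      by rewrite -ML -sb [Some h == _]eq_sym (inj_eq Some_inj) subrr.
    have sP : [&& M \in trips, s \in M & Some s != base M] by rewrite Mt sM.
    have /ffunP/(_ (exist _ (M, s) sP)) := dE.
    by rewrite lfunE !ffunE /= => <-.
  split=> [M Mt ML s t sM tM | s t sL tL].
    have := dxE M s Mt sM; have := dxE M t Mt tM; rewrite (negPf ML).
    by move=> /eqP; rewrite subr_eq0 => /eqP-> /eqP; rewrite subr_eq0 => /eqP->.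
  have := dxE L s Lt sL; have := dxE L t Lt tL; rewrite eqxx => /eqP.
  rewrite subr_eq => /eqP -> /eqP; rewrite subr_eq => /eqP ->; ring.
congr (_ + \dim _)%N; apply/eqP; rewrite eqEsubv subvf /=; apply/subvP => d _.
rewrite [d]coefsE; apply: rpred_sum => x _; apply: memvZ.
case: x => -[L h] xP; have /and3P[/= Lt hL hb] := xP.
have [g [gM gL]] := ind L h Lt hL.
apply/memv_imgP; exists ([ffun t => g t] : coefs K T); first exact: memvf.
rewrite lfunE; apply/ffunP => -[[M s] yP]; have /and3P[/= Mt sM sb] := yP.
rewrite !ffunE -(inj_eq val_inj) /= xpair_eqE /base_coef.
have [b' bE bM'] : exists2 b', base M = Some b' & b' \in M.
  by rewrite /base; case: pickP => [b bM|/(_ s)]; [exists b | rewrite sM].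
rewrite bE !ffunE.
have [ML|ML] := eqVneq M L; last by rewrite (gM M Mt ML s b' sM bM') subrr.
have bL : b' \in L by rewrite -ML.
have := gL s b'; rewrite -ML sM bM' => /(_ isT isT) /eqP.
have -> : (b' == h) = false.
  by apply: contraNF hb => /eqP <-; rewrite -ML bE.
by rewrite subr0 subr_eq => /eqP ->; rewrite /=; ring.
Qed.

End Acyclicity.

(** * Linear forms and derivations *)

Section Forms.
Variables (K : fieldType) (V : vectType K).
Implicit Types (a b : dual V) (p q : Sym V) (theta : Sym V -> Sym V).

Lemma Sym_ind (P : Sym V -> Prop) :
  P 1 -> (forall i, P 'X_i) -> (forall p q, P p -> P q -> P (p * q)) ->
  (forall (c : K) p q, P p -> P q -> P (c *: p + q)) -> forall p, P p.
Proof.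
move=> P1 PX PM PD; have P0 : P 0 by rewrite -(addNr 1) -scaleN1r; apply: PD.
apply: mpolyind => // c m p _ _ Pp; apply: PD => //.
rewrite mpolyXE_id; apply: big_ind => // i _.
by elim: (m i) => [|k IH]; rewrite ?expr0 // exprS; apply: PM.
Qed.

Lemma linear_form_is_linear : linear (@linear_form K V).
Proof.
move=> k a b; rewrite /linear_form scaler_sumr -big_split /=.
apply: eq_bigr => i _; rewrite add_lfunE scale_lfunE scalerDl scalerA //.
Qed.
HB.instance Definition _ :=
  GRing.isLinear.Build K (dual V) (Sym V) _ (@linear_form K V)
    linear_form_is_linear.

Local Notation lf := (@linear_form K V).
Local Notation e i := (tnth (vbasis {:V}) i).

(** The basis of V^* dual to [vbasis {:V}]; these forms give the variables. *)
Definition coordinate (i : 'I_(\dim {:V})) : dual V :=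
  linfun (coord (vbasis {:V}) i : V -> K^o).

Lemma coordinateE i j : coordinate i (e j) = (i == j)%:R.
Proof.
rewrite lfunE /= (tnth_nth 0) coord_free ?(basis_free (vbasisP _)) //.
by rewrite eq_sym.
Qed.

Lemma coordinate_sum a : a = \sum_i (a (e i) : K) *: coordinate i.
Proof.
apply/lfunP => v; rewrite {1}(coord_vbasis (memvf v)) linear_sum sum_lfunE /=.
apply: eq_bigr => i _; rewrite linearZ /= scale_lfunE lfunE /=.
by rewrite -tnth_nth /GRing.scale /= mulrC.
Qed.

Lemma linear_form_coordinate i : lf (coordinate i) = 'X_i.
Proof.
rewrite /linear_form (bigD1 i) //= coordinateE eqxx scale1r big1 ?addr0 //.
by move=> j ji; rewrite coordinateE eq_sym (negPf ji) scale0r.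
Qed.

Lemma mcoeff_linear_form a i : (lf a)@_U_(i) = a (e i).
Proof.
rewrite /linear_form raddf_sum (bigD1 i) //= mcoeffZ mcoeffXU eqxx mulr1.
rewrite big1 ?addr0 // => j ji; rewrite mcoeffZ mcoeffXU (negPf ji) mulr0 //.
Qed.

Lemma linear_form_inj : injective lf.
Proof.
move=> a b ab; rewrite [a]coordinate_sum [b]coordinate_sum.
by apply: eq_bigr => i _; rewrite -!mcoeff_linear_form ab.
Qed.

Lemma linear_form_eq0 a : (lf a == 0) = (a == 0).
Proof. by rewrite -(inj_eq linear_form_inj) linear0. Qed.

Lemma mderiv_variable i j : 'X_j^`M(i) = (i == j)%:R :> Sym V.
Proof.
rewrite mderivX mnm1E eq_sym; have [<-|_] := eqVneq i j; last exact: scale0r.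
have -> : (U_(i) - U_(i))%MM = 0%MM by rewrite -[X in (X - _)%MM]add0m addmK.
by rewrite mpolyX0 scale1r.
Qed.

Lemma derivation_ext (t : dual V -> Sym V) : linear t ->
  exists2 theta, derivation theta & forall a, theta (lf a) = t a.
Proof.
move=> t_lin; pose tL := GRing.isLinear.Build K _ _ _ t t_lin.
pose tt : {linear dual V -> Sym V} := HB.pack t tL.
pose theta (p : Sym V) := \sum_i p^`M(i) * t (coordinate i).
have th_lin : linear theta.
  move=> k p q; rewrite /theta scaler_sumr -big_split /=.
  by apply: eq_bigr => i _; rewrite linearP mulrDl scalerAl.
exists theta; first split=> // p q.
  rewrite /theta mulr_suml mulr_sumr -big_split /=.
  by apply: eq_bigr => i _; rewrite mderivM; ring.
pose thL := GRing.isLinear.Build K _ _ _ theta th_lin.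
pose th : {linear Sym V -> Sym V} := HB.pack theta thL.
have thX i : th 'X_i = tt (coordinate i).
  rewrite /= /theta (bigD1 i) //= mderiv_variable eqxx mul1r.
  by rewrite big1 ?addr0 // => j ji; rewrite mderiv_variable (negPf ji) mul0r.
move=> a; rewrite -[theta]/(th : _ -> _) -[t]/(tt : _ -> _) {2}[a]coordinate_sum.
rewrite /linear_form !linear_sum; apply: eq_bigr => i _.
by rewrite !linearZ thX.
Qed.

Lemma derivation1 theta : derivation theta -> theta 1 = 0.
Proof.
case=> _ /(_ 1 1); rewrite !mulr1 mul1r => /eqP.
by rewrite -subr_eq0 opprD addNKr oppr_eq0 => /eqP.
Qed.

Lemma derivation_eq theta theta' : derivation theta -> derivation theta' ->
  (forall a, theta (lf a) = theta' (lf a)) -> theta =1 theta'.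
Proof.
move=> dth dth' eqa; apply: Sym_ind.
- by rewrite !derivation1.
- by move=> i; rewrite -linear_form_coordinate eqa.
- by move=> p q Ep Eq; rewrite dth.2 dth'.2 Ep Eq.
by move=> c p q Ep Eq; rewrite dth.1 dth'.1 Ep Eq.
Qed.

Lemma derivation_mul_add f theta theta' : derivation theta ->
  derivation theta' -> derivation (fun p => f * theta p + theta' p).
Proof.
move=> [l m] [l' m']; split=> [k p q | p q] /=; last by rewrite m m'; ring.
rewrite l l' -!mul_mpolyC; ring.
Qed.

Lemma derivation0 : derivation (fun _ : Sym V => 0).
Proof. by split=> [k p q|p q]; rewrite ?scaler0 ?mulr0 ?mul0r addr0. Qed.

Lemma derivation_sum (I : finType) (f : I -> Sym V) (th : I -> Sym V -> Sym V) :
  (forall i, derivation (th i)) -> derivation (fun p => \sum_i f i * th i p).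
Proof.
move=> dth; split=> [k p q|p q] /=.
  rewrite scaler_sumr -big_split /=; apply: eq_bigr => i _.
  by rewrite (dth i).1 -!mul_mpolyC; ring.
rewrite mulr_suml mulr_sumr -big_split /=; apply: eq_bigr => i _.
by rewrite (dth i).2; ring.
Qed.

Lemma derivation_linear theta : derivation theta -> linear (fun a => theta (lf a)).
Proof. by move=> dth k a b; rewrite linearP dth.1. Qed.

Definition divides p q : Prop := exists r, q = r * p.

(** For a(v) = 1 this is the quotient map modulo a, followed by the section that
    identifies the quotient with the polynomials constant along v.  It turns
    divisibility by a into an equation. *)
Definition eliminate a (v : V) p : Sym V :=
  p \mPo [tuple 'X_i - (coordinate i v : K) *: lf a | i < \dim {:V}].

Lemma eliminateM a v p q :
  eliminate a v (p * q) = eliminate a v p * eliminate a v q.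
Proof. exact: rmorphM. Qed.

Lemma eliminateD a v p q :
  eliminate a v (p + q) = eliminate a v p + eliminate a v q.
Proof. exact: raddfD. Qed.

Lemma eliminateB a v p q :
  eliminate a v (p - q) = eliminate a v p - eliminate a v q.
Proof. exact: raddfB. Qed.

Lemma eliminate_form a v b : eliminate a v (lf b) = lf (b - (b v : K) *: a).
Proof.
rewrite {1}/linear_form /eliminate linear_sum.
under eq_bigr => i _ do
  rewrite linearZ /= comp_mpolyXU -tnth_nth tnth_mktuple scalerBr scalerA.
rewrite sumrB linearB linearZ -scaler_suml; congr (_ - _ *: _).
rewrite {2}[b]coordinate_sum sum_lfunE; apply: eq_bigr => i _.
by rewrite scale_lfunE.
Qed.

Lemma eliminate_mod a v p : divides (lf a) (p - eliminate a v p).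
Proof.
have el : linear (eliminate a v) by exact: linearP.
elim/Sym_ind: p => [|i|p q [r Er] [s Es]|c p q [r Er] [s Es]].
- by exists 0; rewrite /eliminate rmorph1 subrr mul0r.
- exists (coordinate i v : K)%:MP; rewrite -linear_form_coordinate eliminate_form.
  by rewrite linearB linearZ /= mul_mpolyC; ring.
- exists (r * q + eliminate a v p * s); rewrite eliminateM mulrDl mulrAC -Er -mulrA -Es.
  by ring.
- exists (c *: r + s); rewrite mulrDl -scalerAl -Er -Es el scalerBr; ring.
Qed.

Lemma form_eq1 a : a != 0 -> exists v, a v = 1.
Proof.
move=> a0; have [v av] : exists v, a v != 0.
  by move: a0 => /lfunPn[v]; rewrite zero_lfunE; exists v.
exists ((a v : K)^-1 *: v); rewrite linearZ /= /GRing.scale /= mulVf //.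
Qed.

Lemma eliminate_eq0 a v p : a v = 1 ->
  (eliminate a v p = 0) <-> divides (lf a) p.
Proof.
move=> av; split=> [p0|[r ->]].
  by have := eliminate_mod a v p; rewrite p0 subr0.
by rewrite eliminateM eliminate_form av scale1r subrr linear0 mulr0.
Qed.

Lemma divides_form a b : a != 0 -> divides (lf a) (lf b) -> b \in <[a]>%VS.
Proof.
move=> a0; have [v av] := form_eq1 a0; move/(eliminate_eq0 _ av).
rewrite eliminate_form => /eqP; rewrite linear_form_eq0 subr_eq0 => /eqP ->.
by rewrite memvZ ?memv_line.
Qed.

Lemma divides_prime a b p : a != 0 -> b \notin <[a]>%VS ->
  divides (lf a) (lf b * p) -> divides (lf a) p.
Proof.
move=> a0 ba; have [v av] := form_eq1 a0; move/(eliminate_eq0 _ av).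
rewrite eliminateM => /eqP; rewrite mulf_eq0 => /orP[] /eqP; move/(eliminate_eq0 _ av).
  by move/(divides_form a0) => ab; rewrite ab in ba.
by [].
Qed.

Lemma coprime_syzygy a b p q : a != 0 -> b \notin <[a]>%VS ->
  lf a * p = lf b * q -> exists r, p = lf b * r /\ q = lf a * r.
Proof.
move=> a0 ba E; have [r qE] : divides (lf a) q.
  by apply: divides_prime ba _ => //; exists p; rewrite -E mulrC.
exists r; split; last by rewrite qE mulrC.
apply: (@mulfI _ (lf a)); first by rewrite linear_form_eq0.
by rewrite E qE; ring.
Qed.

(** Exactness in the middle of the Koszul complex of three independent forms:
    modulo the first one, the relation is a syzygy of two coprime forms. *)
Lemma koszul a b c p q r : a != 0 -> b \notin <[a]>%VS ->
  c \notin (<[a]> + <[b]>)%VS ->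
  lf c * p - lf b * q + lf a * r = 0 ->
  exists e, [/\ p = lf b * e.1.1 - lf a * e.1.2,
    q = lf c * e.1.1 - lf a * e.2 & r = lf c * e.1.2 - lf b * e.2].
Proof.
move=> a0 ba cab E; have [v av] := form_eq1 a0.
pose b' := b - (b v : K) *: a; pose c' := c - (c v : K) *: a.
have b'0 : b' != 0.
  by apply: contraNneq ba => /eqP; rewrite subr_eq0 => /eqP ->; rewrite memvZ ?memv_line.
have c'b' : c' \notin <[b']>%VS.
  apply: contra cab => /vlineP[k /eqP]; rewrite subr_eq => /eqP ->.
  rewrite /b' scalerBr -addrA addrC; apply: memv_add; last by rewrite memvZ ?memv_line.
  by rewrite addrC scalerA -scaleNr -scalerDl memvZ ?memv_line.
have el : linear (eliminate a v) by exact: linearP.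
have E' : lf b' * eliminate a v q = lf c' * eliminate a v p.
  apply/eqP; rewrite -subr_eq0 -oppr_eq0 opprB -!eliminate_form -!eliminateM.
  apply/eqP; transitivity (eliminate a v (lf c * p - lf b * q + lf a * r)).
    rewrite eliminateD eliminateB (eliminateM _ _ (lf a)).
    rewrite [eliminate a v (lf a)]eliminate_form av scale1r subrr linear0.
    by rewrite mul0r addr0.
  by rewrite E /eliminate raddf0.
have [e [qE pE]] := coprime_syzygy b'0 c'b' E'.
have [e2 e2E] := eliminate_mod a v p; have [e3 e3E] := eliminate_mod a v q.
have lb' : lf b' = lf b - (b v : K)%:MP * lf a by rewrite linearB linearZ /= mul_mpolyC.
have lc' : lf c' = lf c - (c v : K)%:MP * lf a by rewrite linearB linearZ /= mul_mpolyC.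
pose f2 := (b v : K)%:MP * e - e2; pose f3 := (c v : K)%:MP * e - e3.
have pE' : p = lf b * e - lf a * f2.
  by rewrite -[p](subrK (eliminate a v p)) e2E pE lb' /f2; ring.
have qE' : q = lf c * e - lf a * f3.
  by rewrite -[q](subrK (eliminate a v q)) e3E qE lc' /f3; ring.
exists ((e, f2), f3); split=> //=.
apply: (@mulfI _ (lf a)); first by rewrite linear_form_eq0.
have -> : lf a * r = - (lf c * p) + lf b * q.
  by apply/eqP; rewrite -subr_eq0 -E; apply/eqP; ring.
by rewrite pE' qE'; ring.
Qed.

(** The degree 1 component of a polynomial, as an element of V^*; it passes from
    a derivation to an endomorphism of V^*. *)
Definition linear_part p : dual V :=
  \sum_i (p^`M(i).@[fun=> 0] : K) *: coordinate i.

Lemma linear_part_is_linear : linear linear_part.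
Proof.
move=> k p q; rewrite /linear_part scaler_sumr -big_split /=.
by apply: eq_bigr => i _; rewrite linearP /= mevalD mevalZ scalerDl scalerA.
Qed.

Lemma linear_part_form p a : linear_part (p * lf a) = p.@[fun=> 0] *: a.
Proof.
rewrite {2}[a]coordinate_sum scaler_sumr; apply: eq_bigr => i _.
rewrite scalerA mderivM mevalD !mevalM; congr (_ *: _).
have -> : (lf a).@[fun=> 0] = 0.
  by rewrite /linear_form raddf_sum big1 // => j _; rewrite /= mevalZ mevalXU mulr0.
have -> : (lf a)^`M(i) = \sum_j (a (e j) : K) *: ('X_j)^`M(i).
  by rewrite (raddf_sum (mderiv i)); apply: eq_bigr => j _; apply: mderivZ.
rewrite (bigD1 i) // mderiv_variable eqxx big1.
  by rewrite mulr0 add0r /= addr0 mevalZ meval1 mulr1.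
by move=> j ji; rewrite mderiv_variable eq_sym (negPf ji) scaler0.
Qed.

End Forms.

(** * Free arrangements have acyclic lines *)
Section LineFunctionals.
Variables (K : fieldType) (E : vectType K) (T : finType) (al : T -> E).
Hypothesis als : simple al.
Local Notation trips := (trips al).

Lemma plane_unique a b k l m n : a != b ->
  k *: al a + l *: al b = m *: al a + n *: al b -> k = m /\ l = n.
Proof.
move=> ab; move/eqP; rewrite -subr_eq0 opprD addrACA -!scalerBl => /eqP E0.
have [/eqP|ln] := eqVneq (l - n) 0.
  rewrite subr_eq0 => /eqP ln; move: E0; rewrite ln subrr scale0r addr0 => /eqP.
  by rewrite scaler_eq0 (negPf (als.1 a)) orbF subr_eq0 => /eqP.
case/eqP: ab; apply/esym/als.2/vlineP; exists (- ((l - n)^-1 * (k - m))).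
apply: (scalerI ln); rewrite scalerA mulrN mulVKf // scaleNr.
by apply/eqP; rewrite -subr_eq0 opprK addrC E0.
Qed.

(** On a line two coefficients can be prescribed, and the relations propagate
    them to the other points. *)
Lemma line_functional a b (u : T -> K) : a != b ->
  (forall c, c \in relations al (line al a b) -> \sum_t (c t : K) * u t = 0) ->
  exists2 v : E -> K^o, linear v &
    forall t, t \in line al a b -> u t = v (al t).
Proof.
move=> ab urel.
have [c|v v_lin vE] := @linear_extension K E bool
    (fun i : bool => if i then al b else al a) K^o
    (fun i : bool => if i then u b else u a).
  rewrite combE !big_bool /= addrC => cE.
  have [|ca cb] := @plane_unique a b (c false) (c true) 0 0 ab.
    by rewrite cE !scale0r addr0.
  by rewrite ca cb !scale0r addr0.
exists v => // t; rewrite inE => /planeP[k [l tE]].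
pose c : coefs K T := delta K t - (k *: delta K a + l *: delta K b).
have cr : c \in relations al (line al a b).
  apply/relationsP; split=> [s sL|]; last first.
    by rewrite linearB linearD !linearZ /= !comb_delta tE subrr.
  have nt x : x \in line al a b -> (s == x) = false.
    by move=> xL; apply: contraNF sL => /eqP ->.
  have tL : t \in line al a b by rewrite inE; apply/planeP; exists k, l.
  rewrite !ffunE (nt t) // (nt a) ?line_l // (nt b) ?line_r //.
  by rewrite !scaler0 addr0 subr0.
have vc x y : v (x *: al a + y *: al b) = x * u a + y * u b :> K.
  have v0 : v 0 = 0 by rewrite -(addNr 0) -scaleN1r v_lin scaleN1r addNr.
  by rewrite v_lin -[y *: al b]addr0 v_lin (vE true) (vE false) v0 addr0.
have := urel c cr; rewrite tE vc.
have -> : \sum_s (c s : K) * u s = u t - (k * u a + l * u b).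
  rewrite -[u t](sum_delta (u : T -> K^o)) -[u a](sum_delta (u : T -> K^o)).
  rewrite -[u b](sum_delta (u : T -> K^o)) !mulr_sumr -big_split -sumrB.
  by apply: eq_bigr => s _; rewrite !ffunE /GRing.scale /=; ring.
by move/eqP; rewrite subr_eq0 => /eqP.
Qed.

Lemma relations_pair a b : a != b -> line al a b \notin trips ->
  relations al (line al a b) = 0%VS.
Proof.
move=> ab nt; apply/eqP; rewrite -dimv_eq0.
have := dim_relations al (line al a b).
rewrite line_spanned // dim_plane //; set d := \dim _ => dE.
have : ~~ (2 < #|line al a b|)%N.
  by apply: contra nt => l3; apply/tripsP; exists a, b.
by rewrite -dE addn2; case: d {dE}.
Qed.

Hypothesis decomp : lines_decompose al.

(** Decomposability lets a functional on the relations of one line be extended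
    by zero to all others. *)
Lemma isolating_coefficients L h : L \in trips -> h \in L ->
  exists u : T -> K,
    (forall t, t \in L -> u t = (t == h)%:R) /\
    forall a b, a != b -> line al a b != L ->
      exists2 v : E -> K^o, linear v &
        forall t, t \in line al a b -> u t = v (al t).
Proof.
move=> Lt hL; pose C := (\sum_(M in trips | M != L) relations al M)%VS.
have RC : (relations al L :&: C)%VS = 0%VS.
  by have /directv_sumP := decomp.2; apply.
pose pr := daddv_pi (relations al L) C.
pose u0 t : K := pr (delta K t) h.
have uE (c : coefs K T) : \sum_t (c t : K) * u0 t = pr c h.
  rewrite {2}[c]coefsE linear_sum sum_ffunE; apply: eq_bigr => t _.
  by rewrite linearZ /= !ffunE.
have uL c : c \in relations al L -> \sum_t (c t : K) * u0 t = c h.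
  by move=> cL; rewrite uE /pr daddv_pi_id.
have u0M M : M \in trips -> M != L ->
    forall c, c \in relations al M -> \sum_t (c t : K) * u0 t = 0.
  move=> Mt ML c cM; rewrite uE /pr.
  have cC : c \in C by apply: (subvP (sumv_sup M _ (subvv _))); rewrite ?Mt.
  have c0 : c \in (relations al L + C)%VS by apply: (subvP (addvSr _ _)).
  have := daddv_pi_add RC c0; rewrite (daddv_pi_id _ cC) 1?capvC // => /eqP.
  by rewrite -subr_eq0 addrK => /eqP ->; rewrite ffunE.
have [a [b [ab LE _]]] := tripsP _ _ Lt.
have [|v v_lin vE] := @line_functional a b (fun t => u0 t - (t == h)%:R) ab.
  move=> c; rewrite -LE => cL; under eq_bigr => t _ do rewrite mulrBr.
  rewrite sumrB uL // (bigD1 h) //= eqxx mulr1 big1 ?addr0 ?subrr // => t th.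
  by rewrite (negPf th) mulr0.
exists (fun t => u0 t - v (al t)); split=> [t|a' b' ab' nL].
  by rewrite LE => /vE <-; ring.
have [|w w_lin wE] := @line_functional a' b' u0 ab'.
  move=> c; have [Mt|nMt] := boolP (line al a' b' \in trips); first exact: u0M.
  rewrite relations_pair // memv0 => /eqP ->; apply: big1 => t _.
  by rewrite ffunE mul0r.
exists (fun x => w x - v x) => [k x y|t tL]; last by rewrite -wE.
by rewrite w_lin v_lin scalerBr; ring.
Qed.

End LineFunctionals.

Section Solvability.
Variables (K : fieldType) (V : vectType K) (T : finType) (al : T -> dual V).
Hypothesis als : simple al.
Local Notation trips := (trips al).
Local Notation lf := (@linear_form K V).

Definition logarithmic (theta : Sym V -> Sym V) : Prop :=
  derivation theta /\ forall t, divides (lf (al t)) (theta (lf (al t))).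

(** Freeness of the module of logarithmic derivations, for forms indexed by a
    finite type instead of a set of hyperplanes. *)
Definition log_free : Prop :=
  exists (m : nat) (b : 'I_m -> Sym V -> Sym V),
    (forall i, logarithmic (b i)) /\
    (forall theta, logarithmic theta ->
       exists! c : {ffun 'I_m -> Sym V},
         forall p, theta p = \sum_(i < m) c i * b i p).

Lemma logarithmic0 : logarithmic (fun=> 0).
Proof. by split=> [|t]; [apply: derivation0 | exists 0; rewrite mul0r]. Qed.

Lemma logarithmic_sum (I : finType) (f : I -> Sym V) (th : I -> Sym V -> Sym V) :
  (forall i, logarithmic (th i)) -> logarithmic (fun p => \sum_i f i * th i p).
Proof.
move=> lth; split; first by apply: derivation_sum => i; case: (lth i).
move=> t; have q_ i : exists q, th i (lf (al t)) = q * lf (al t) by apply: (lth i).2.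
have [q qE] := fin_all_exists q_.
exists (\sum_i f i * q i); rewrite mulr_suml; apply: eq_bigr => i _.
by rewrite qE mulrA.
Qed.

Variable w : T -> Sym V.

(** For w t = u t * lf (al h) with scalars u t, the vector w represents a class in
    the cokernel of the map that sends a family q to the family of the
    q t * lf (al t) modulo derivations; f is solvable when it annihilates this
    class.  The aim is to show that 1 does. *)
Definition solvable f : Prop :=
  exists2 theta, derivation theta &
    forall t, divides (lf (al t)) (f * w t - theta (lf (al t))).

Lemma solvableM f g : solvable f -> solvable (f * g).
Proof.
move=> [th dth fth]; exists (fun p => g * th p + 0).
  exact: (derivation_mul_add _ dth (@derivation0 _ _)).
move=> t; have [q qE] := fth t; exists (g * q).
by rewrite -[RHS]mulrA -qE; ring.
Qed.

Hypothesis free : log_free.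

(** This is the only place where freeness is used: Koszul cycles in a free module
    are boundaries, coordinate by coordinate. *)
Lemma logarithmic_koszul (a b c : dual V) (d12 d13 d23 : Sym V -> Sym V) :
  a != 0 -> b \notin <[a]>%VS -> c \notin (<[a]> + <[b]>)%VS ->
  logarithmic d12 -> logarithmic d13 -> logarithmic d23 ->
  (forall p, lf c * d12 p - lf b * d13 p + lf a * d23 p = 0) ->
  exists e1 e2 e3, [/\ logarithmic e1, logarithmic e2, logarithmic e3,
    forall p, d12 p = lf b * e1 p - lf a * e2 p &
    forall p, d13 p = lf c * e1 p - lf a * e3 p].
Proof.
move=> a0 ba cab l12 l13 l23 rel0; have [m [B [lB Bgen]]] := free.
have [[c12 [c12E _]] [c13 [c13E _]]] := (Bgen _ l12, Bgen _ l13).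
have [c23 [c23E _]] := Bgen _ l23.
have crel i : lf c * c12 i - lf b * c13 i + lf a * c23 i = 0.
  have [z [_ zU]] := Bgen _ logarithmic0.
  have z0 : z = [ffun=> 0].
    by apply: zU => p; rewrite big1 // => j _; rewrite ffunE mul0r.
  have : z = [ffun j => lf c * c12 j - lf b * c13 j + lf a * c23 j].
    apply: zU => p; rewrite -[LHS](rel0 p) c12E c13E c23E !mulr_sumr -sumrB -big_split /=.
    by apply: eq_bigr => j _; rewrite ffunE /=; ring.
  by rewrite z0 => /ffunP/(_ i); rewrite !ffunE => <-.
have [e eE] := fin_all_exists (fun i => koszul a0 ba cab (crel i)).
exists (fun p => \sum_i (e i).1.1 * B i p), (fun p => \sum_i (e i).1.2 * B i p).
exists (fun p => \sum_i (e i).2 * B i p); split; try exact: logarithmic_sum.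
  move=> p; rewrite c12E !mulr_sumr -sumrB; apply: eq_bigr => i _.
  by have [-> _ _] := eE i; ring.
move=> p; rewrite c13E !mulr_sumr -sumrB; apply: eq_bigr => i _.
by have [_ -> _] := eE i; ring.
Qed.

(** A derivation is divisible by a form as soon as its values on the variables
    are, and b is a nonzero divisor modulo a. *)
Lemma divide_derivation a b theta theta' : a != 0 -> b \notin <[a]>%VS ->
  derivation theta -> derivation theta' ->
  (forall p, lf b * theta p = lf a * theta' p) ->
  exists2 eta, derivation eta &
    forall p, theta p = lf a * eta p /\ theta' p = lf b * eta p.
Proof.
move=> a0 ba dth dth' E.
have q_ i : exists q, theta (lf (coordinate i)) = q * lf a.
  apply: (divides_prime a0 ba); exists (theta' (lf (coordinate i))).
  by rewrite E mulrC.
have [q qE] := fin_all_exists q_.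
pose t (x : dual V) := \sum_i (x (tnth (vbasis {:V}) i) : K) *: q i.
have t_lin : linear t.
  move=> k x y; rewrite /t scaler_sumr -big_split /=; apply: eq_bigr => i _.
  by rewrite add_lfunE scale_lfunE scalerDl scalerA.
have [eta deta etaE] := derivation_ext t_lin.
have thE p : theta p = lf a * eta p.
  have d0 : derivation (fun p => lf a * eta p + 0).
    exact: (derivation_mul_add _ deta (@derivation0 _ _)).
  rewrite (derivation_eq dth d0) ?addr0 // => x; rewrite addr0 etaE.
  have -> : theta (lf x) =
      \sum_i (x (tnth (vbasis {:V}) i) : K) *: theta (lf (coordinate i)).
    pose thL := GRing.isLinear.Build K _ _ _ _ (derivation_linear dth).
    pose th : {linear dual V -> Sym V} := HB.pack (fun x => theta (lf x)) thL.
    rewrite -[LHS]/(th x) {1}[x]coordinate_sum linear_sum; apply: eq_bigr => i _.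
    by rewrite linearZ.
  rewrite mulr_sumr; apply: eq_bigr => i _; rewrite qE -scalerAr mulrC //.
exists eta => // p; split=> //; apply: (@mulfI _ (lf a)).
  by rewrite linear_form_eq0.
by rewrite -E thE; ring.
Qed.

(** The annihilator of the class of w has no associated prime that contains three
    independent forms: the cokernel has projective dimension at most 2.  The
    three solutions differ by logarithmic derivations; correcting them by a
    Koszul boundary makes them proportional to the three forms. *)
Lemma solvable_three f (a b c : dual V) :
  a != 0 -> b \notin <[a]>%VS -> c \notin (<[a]> + <[b]>)%VS ->
  solvable (f * lf a) -> solvable (f * lf b) -> solvable (f * lf c) ->
  solvable f.
Proof.
move=> a0 ba cab [t1 d1 f1] [t2 d2 f2] [t3 d3 f3].
have lg x y tx ty : derivation tx -> derivation ty ->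
    (forall t, divides (lf (al t)) (f * lf x * w t - tx (lf (al t)))) ->
    (forall t, divides (lf (al t)) (f * lf y * w t - ty (lf (al t)))) ->
    logarithmic (fun p => lf y * tx p + (- lf x * ty p + 0)).
  move=> dx dy fx fy; split.
    apply: derivation_mul_add => //.
    exact: (derivation_mul_add _ dy (@derivation0 _ _)).
  move=> t; have [q qE] := fx t; have [r rE] := fy t; exists (lf x * r - lf y * q).
  have -> : tx (lf (al t)) = f * lf x * w t - q * lf (al t) by rewrite -qE; ring.
  have -> : ty (lf (al t)) = f * lf y * w t - r * lf (al t) by rewrite -rE; ring.
  by ring.
have [|e1 [e2 [e3 [l1 l2 l3 E12 E13]]]] :=
  logarithmic_koszul a0 ba cab (lg _ _ _ _ d1 d2 f1 f2) (lg _ _ _ _ d1 d3 f1 f3)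
    (lg _ _ _ _ d2 d3 f2 f3).
  by move=> p; ring.
pose s1 p := (-1) * e1 p + t1 p; pose s2 p := (-1) * e2 p + t2 p.
have ds1 : derivation s1 by apply: derivation_mul_add => //; case: l1.
have ds2 : derivation s2 by apply: derivation_mul_add => //; case: l2.
have [|eta deta etaE] := @divide_derivation a b s1 s2 a0 ba ds1 ds2.
  move=> p; apply/eqP; rewrite -subr_eq0 /s1 /s2; apply/eqP.
  transitivity ((lf b * t1 p + (- lf a * t2 p + 0)) - (lf b * e1 p - lf a * e2 p)).
    by ring.
  by rewrite E12 subrr.
exists eta => // t.
have dv x s e tx : (forall t, divides (lf (al t)) (f * lf x * w t - tx (lf (al t)))) ->
    logarithmic e -> (forall p, s p = -1 * e p + tx p) ->
    (forall p, s p = lf x * eta p) ->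
    divides (lf (al t)) (lf x * (f * w t - eta (lf (al t)))).
  move=> fx [_ le] sE sx; have [q qE] := fx t; have [r rE] := le t.
  exists (q + r); rewrite mulrDl -qE -rE mulrBr -sx sE; ring.
(* At most one of a and b is proportional to al t; the other one cancels. *)
have [a_t|a_t] := boolP (a \in <[al t]>%VS); last first.
  apply: (divides_prime (als.1 t) a_t); apply: (dv a s1 e1 t1) => // p.
  by case: (etaE p).
have b_t : b \notin <[al t]>%VS.
  apply: contra ba => b_t; have [k aE] := vlineP _ _ a_t.
  have k0 : k != 0 by apply: contraNneq a0 => k0; rewrite aE k0 scale0r.
  have [l ->] := vlineP _ _ b_t; apply/vlineP; exists (l / k).
  by rewrite aE scalerA divfK.
apply: (divides_prime (als.1 t) b_t); apply: (dv b s2 e2 t2) => // p.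
by case: (etaE p).
Qed.

(** The product of the forms off the line through s and t is solvable, and each
    of its factors is independent of al s and al t, so that [solvable_three]
    removes the factors one at a time. *)
Lemma solvable_strip2 f s t : s != t ->
  solvable (\prod_(r in ~: line al s t) lf (al r)) ->
  solvable (f * lf (al s)) -> solvable (f * lf (al t)) -> solvable f.
Proof.
move=> st; rewrite -big_enum => sol fs ft.
have {sol} := solvableM f sol; rewrite mulrC.
have : all (fun r => r \notin line al s t) (enum (~: line al s t)).
  by apply/allP => r; rewrite mem_enum inE.
elim: (enum _) => [|r rs IH] /=; first by rewrite big_nil mulr1.
case/andP=> rst /IH {}IH; rewrite big_cons mulrCA mulrC => sol; apply: IH.
have sr x : solvable (f * lf (al x)) ->
    solvable (f * (\prod_(i <- rs) lf (al i)) * lf (al x)).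
  by move=> fx; rewrite mulrAC; apply: solvableM.
apply: (solvable_three (als.1 s) _ _ (sr s fs) (sr t ft) sol).
  by apply: contra st => ts; apply/eqP/esym/als.2.
by move: rst; rewrite inE.
Qed.

End Solvability.

Section FreeImpliesAcyclic.
Variables (K : fieldType) (V : vectType K) (T : finType) (al : T -> dual V).
Hypothesis als : simple al.
Local Notation trips := (trips al).
Local Notation lf := (@linear_form K V).
Hypothesis decomp : lines_decompose al.
Hypothesis free : log_free al.

(** The coefficients u come from a functional on the relations that sees the line
    L only.  On any given line they are, away from h, the values of a functional,
    so that the class of w dies at the generic points of every flat of rank 2:
    the product of the forms off a line is solvable.  Starting from such a
    product one removes all its factors; removing al a uses a product over the
    complement of a line through a, whose factors are independent of al a. *)
Lemma solvable_isolating L h : L \in trips -> h \in L ->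
  exists u : T -> K, [/\ forall t, t \in L -> u t = (t == h)%:R,
   forall M, M \in trips -> M != L ->
     exists2 v : dual V -> K^o, linear v & forall t, t \in M -> u t = v (al t) &
   solvable al (fun t => u t *: lf (al h)) 1].
Proof.
move=> Lt hL; have [u [uL uM]] := isolating_coefficients als decomp Lt hL.
exists u; split=> // [M Mt ML|].
  by have [a [b [ab ME _]]] := tripsP _ _ Mt; rewrite ME in ML *; apply: uM.
pose w t := u t *: lf (al h).
have off a b : a != b -> solvable al w (\prod_(r in ~: line al a b) lf (al r)).
  move=> ab; set P := \prod_(r in _) _.
  have [v v_lin vE] : exists2 v : dual V -> K^o, linear v &
      forall t, t \in line al a b -> t = h \/ u t = v (al t).
    have [LE|nL] := eqVneq (line al a b) L; last first.
      by have [v v_lin vE] := uM a b ab nL; exists v => // t /vE; right.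
    exists (fun=> 0) => [k x y|t]; first by rewrite scaler0 addr0.
    rewrite LE => tL; rewrite uL //; have [->|_] := eqVneq t h; by [left | right].
  have [th dth thE] : exists2 theta, derivation theta &
      forall x, theta (lf x) = (v x : K) *: (P * lf (al h)).
    apply: derivation_ext => k x y.
    by rewrite v_lin scalerDl -scalerA.
  exists th => // t; rewrite thE /w -scalerAr -scalerBl.
  have [tL|tL] := boolP (t \in line al a b).
    have [->|->] := vE t tL; last by exists 0; rewrite subrr scale0r mul0r.
    by exists ((u h - v (al h)) *: P); rewrite scalerAl.
  have [Q ->] : exists Q, P = lf (al t) * Q.
    by rewrite /P (bigD1 t) ?in_setC //; eexists.
  exists ((u t - v (al t)) *: (Q * lf (al h))).
  by rewrite -!scalerAl; congr (_ *: _); ring.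
have strip1 f a : solvable al w (f * lf (al a)) -> solvable al w f.
  move=> fa; have [b _ /andP[ba _]] := trip_third a a Lt.
  rewrite eq_sym in ba; have := solvableM f (off a b ba); rewrite mulrC -big_enum.
  have : all (fun r => r \notin line al a b) (enum (~: line al a b)).
    by apply/allP => r; rewrite mem_enum inE.
  elim: (enum _) => [|r rs IH] /=; first by rewrite big_nil mulr1.
  case/andP=> rab /IH {}IH; rewrite big_cons mulrCA mulrC => sol; apply: IH.
  have ar : a != r by apply: contraNneq rab => <-; apply: line_l.
  apply: (solvable_strip2 als free ar (off a r ar)) => //.
  by rewrite mulrAC; apply: solvableM.
(* Any line provides a solvable product to start from. *)
have [a [b [ab _ _]]] := tripsP _ _ Lt.
have := off a b ab; rewrite -big_enum.
elim: (enum _) => [|r rs IH]; first by rewrite big_nil.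
by rewrite big_cons /= mulrC => /strip1.
Qed.

(** The points of a line are pairwise independent vectors of a plane, so that a
    linear map with three of them as eigenvectors is a scalar on the plane. *)
Lemma eigen_constant (phi : dual V -> dual V) (g : T -> K) M :
  linear phi -> M \in trips -> (forall t, t \in M -> phi (al t) = g t *: al t) ->
  constant_on M g.
Proof.
move=> phi_lin Mt phiE s t sM tM; have [->//|st] := eqVneq s t.
have [r rM /andP[rs rt]] := trip_third s t Mt.
move: (rM); rewrite (trip_line als Mt st sM tM) inE.
case/(coll_coefs als rs rt) => k [l [k0 l0 rE]].
have phi0 : phi 0 = 0 by rewrite -{1}(addNr 0) -scaleN1r phi_lin scaleN1r addNr.
have := phiE r rM; rewrite rE phi_lin -[l *: al t]addr0 phi_lin phi0 !addr0.
rewrite !phiE // scalerDr !scalerA => /(plane_unique als st)[].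
by rewrite ![g r * _]mulrC => /(mulfI k0) -> /(mulfI l0) ->.
Qed.

(** The degree 1 part of a solution for 1 is a linear map that has the forms of
    each line as eigenvectors, up to the correction by u; the eigenvalues are the
    function sought. *)
Theorem free_acyclic : acyclic K (collinear al).
Proof.
apply/(acyclicP als) => L h Lt hL.
have [u [uL uM [eta deta sol]]] := solvable_isolating Lt hL.
have [q qE] := fin_all_exists sol.
pose eta0 x := linear_part (eta (lf x)).
have eta0_lin : linear eta0.
  by move=> k x y; rewrite /eta0 derivation_linear // linear_part_is_linear.
have eta0E t : u t *: al h - eta0 (al t) = (q t).@[fun=> 0] *: al t.
  rewrite -linear_part_form -qE mul1r.
  have -> : u t *: lf (al h) - eta (lf (al t))
          = (-1) *: eta (lf (al t)) + (u t)%:MP * lf (al h).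
    by rewrite scaleN1r addrC mul_mpolyC.
  by rewrite linear_part_is_linear linear_part_form mevalC scaleN1r addrC.
exists (fun t => (q t).@[fun=> 0]); split=> [M Mt ML|].
  have [v v_lin vE] := uM M Mt ML.
  apply: (@eigen_constant (fun x => (v x : K) *: al h - eta0 x)) => // [k x y|t tM].
    by rewrite v_lin eta0_lin scalerDl -scalerA scalerBr opprD addrACA.
  by rewrite -vE // eta0E.
apply: (@eigen_constant (fun x => - eta0 x)) => // [k x y|t tL].
  by rewrite eta0_lin opprD scalerN.
rewrite scalerBl -eta0E uL //.
have -> : ((t == h)%:R : K) *: al h = (t == h)%:R *: al t.
  by case: eqP => [->|_]; rewrite ?scale0r.
by rewrite addrAC subrr add0r.
Qed.

End FreeImpliesAcyclic.

(** * Acyclic lines give a basis of the logarithmic derivations *)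
Section AcyclicImpliesFree.
Variables (K : fieldType) (V : vectType K) (T : finType) (al : T -> dual V).
Hypothesis als : simple al.
Local Notation trips := (trips al).
Local Notation lf := (@linear_form K V).
Local Notation comb := (comb al).

Lemma form_neq0 t : lf (al t) != 0.
Proof. by rewrite linear_form_eq0 als.1. Qed.

Lemma divides_strip s (r : seq T) p : s \notin r ->
  divides (lf (al s)) ((\prod_(t <- r) lf (al t)) * p) -> divides (lf (al s)) p.
Proof.
elim: r => [|t r IH] /=; first by rewrite big_nil mul1r.
rewrite inE negb_or big_cons /= => /andP[st sr]; rewrite -mulrA.
move/(divides_prime (als.1 s)) => dv; apply: IH => //; apply: dv.
by apply: contra st => /als.2 ->.
Qed.

Lemma divides_prod (r : seq T) p : uniq r ->
  (forall t, t \in r -> divides (lf (al t)) p) ->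
  divides (\prod_(t <- r) lf (al t)) p.
Proof.
elim: r => [|t r IH] /=; first by exists p; rewrite big_nil mulr1.
case/andP=> tr ur dv; have [|q qE] := IH ur.
  by move=> s sr; apply: dv; rewrite inE sr orbT.
have [q' q'E] : divides (lf (al t)) q.
  by apply: (divides_strip tr); rewrite mulrC -qE; apply: dv; rewrite inE eqxx.
by exists q'; rewrite big_cons /= qE q'E mulrA.
Qed.

(** The families (f t * lf (al t)) that respect the relations in D, that is, for
    all relations, the families of values of a logarithmic derivation. *)
Definition balanced (D : {vspace coefs K T}) (f : T -> Sym V) : Prop :=
  forall x, x \in D -> \sum_t (x t : K) *: (f t * lf (al t)) = 0.

Lemma sum_form (c : coefs K T) : \sum_t (c t : K) *: lf (al t) = lf (comb c).
Proof.
by rewrite combE linear_sum; apply: eq_bigr => t _; rewrite linearZ.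
Qed.

Lemma balanced_derivation f : balanced (lker comb) f ->
  exists2 theta, logarithmic al theta &
    forall t, theta (lf (al t)) = f t * lf (al t).
Proof.
move=> fb; have [c c0|tau tau_lin tauE] :=
  @linear_extension K (dual V) T al (Sym V) (fun t => f t * lf (al t)).
  by apply: fb; rewrite memv_ker c0.
have [th dth thE] := derivation_ext tau_lin.
have thf t : th (lf (al t)) = f t * lf (al t) by rewrite thE tauE.
by exists th => //; split=> // t; exists (f t); rewrite thf.
Qed.

Lemma logarithmic_balanced theta f : derivation theta ->
  (forall t, theta (lf (al t)) = f t * lf (al t)) -> balanced (lker comb) f.
Proof.
move=> dth fE x; rewrite memv_ker => /eqP x0.
have thL := derivation_linear dth.
pose thB := GRing.isLinear.Build K _ _ _ (fun a => theta (lf a)) thL.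
pose th : {linear dual V -> Sym V} := HB.pack (fun a => theta (lf a)) thB.
transitivity (th (comb x)); last by rewrite x0 linear0.
by rewrite combE linear_sum; apply: eq_bigr => t _; rewrite linearZ /= -fE.
Qed.

Lemma balanced_add D f g h : balanced D f -> balanced D g ->
  balanced D (fun t => f t + h * g t).
Proof.
move=> fb gb x xD.
rewrite (eq_bigr (fun t => (x t : K) *: (f t * lf (al t)) +
   h * ((x t : K) *: (g t * lf (al t))))).
  by rewrite big_split /= -mulr_sumr fb // gb // mulr0 addr0.
by move=> t _; rewrite -!mul_mpolyC; ring.
Qed.

Lemma balanced_const (L : {set T}) (f : T -> Sym V) :
  constant_on L f -> balanced (relations al L) f.
Proof.
move=> fL x /relationsP[xL x0]; have [L0|[s sL]] := set_0Vmem L.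
  by rewrite big1 // => t _; rewrite xL ?L0 ?inE // scale0r.
rewrite (eq_bigr (fun t => f s * ((x t : K) *: lf (al t)))).
  by rewrite -mulr_sumr sum_form x0 linear0 mulr0.
move=> t _; have [tL|tL] := boolP (t \in L); last by rewrite xL // !scale0r mulr0.
by rewrite (fL t s) // scalerAr.
Qed.

Lemma balanced_eq (L : {set T}) (f g : T -> Sym V) : (forall t, t \in L -> f t = g t) ->
  balanced (relations al L) g -> balanced (relations al L) f.
Proof.
move=> fg gb x xr; rewrite -[RHS](gb x xr); apply: eq_bigr => t _.
have [xL _] := relationsP _ _ _ xr.
by have [tL|tL] := boolP (t \in L); [rewrite fg | rewrite xL // !scale0r].
Qed.

(** On a line the balanced functions form a free module, with basis the
    constant 1 and one function more. *)
Lemma line_module L : L \in trips -> exists c : T -> Sym V,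
  [/\ balanced (relations al L) c,
      forall f, balanced (relations al L) f ->
        exists a b, forall t, t \in L -> f t = a + b * c t
    & forall a b, (forall t, t \in L -> a + b * c t = 0) -> b = 0].
Proof.
move=> Lt; have [h0 [h1 [h01 LE _]]] := tripsP _ _ Lt.
have h0L : h0 \in L by rewrite LE line_l.
have h1L : h1 \in L by rewrite LE line_r.
have ky_ t : exists ky : K * K, t \in L -> al t = ky.1 *: al h0 + ky.2 *: al h1.
  have [|tL] := boolP (t \in L); last by exists (0, 0).
  by rewrite {1}LE inE => /planeP[k [y tE]]; exists (k, y).
have [ky kyE] := fin_all_exists ky_; pose y t := (ky t).2.
have y0 : y h0 = 0.
  have := kyE h0 h0L; rewrite -{1}[al h0]scale1r -{1}[_ *: al h0]addr0.
  by rewrite -{1}(scale0r (al h1)) => /(plane_unique als h01)[].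
have y1 : y h1 = 1.
  have := kyE h1 h1L; rewrite -{1}[al h1]scale1r -{1}[_ *: al h1]add0r.
  by rewrite -{1}(scale0r (al h0)) => /(plane_unique als h01)[].
pose Ls := enum (L :\ h0).
(* The values, divided by the forms, of Q times the derivative in the direction
   of a vector on which h0 vanishes and h1 takes the value 1. *)
pose c t := if t == h0 then 0 else y t *: \prod_(s <- rem t Ls) lf (al s).
pose Q := \prod_(s <- Ls) lf (al s).
have cE t : t \in L -> c t * lf (al t) = y t *: Q.
  move=> tL; rewrite /c; case: eqP => [->|/eqP th0].
    by rewrite y0 scale0r mul0r.
  have tLs : t \in Ls by rewrite mem_enum !inE th0.
  by rewrite /Q (perm_big _ (perm_to_rem tLs)) big_cons /= -scalerAl mulrC.
exists c; split.
- move=> x xr; have [xL x0] := relationsP _ _ _ xr.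
  rewrite (eq_bigr (fun t => ((x t : K) * y t) *: Q)).
    rewrite -scaler_suml; suff -> : \sum_t (x t : K) * y t = 0 by rewrite scale0r.
    have [|_ -> //] := @plane_unique _ _ _ _ als h0 h1 (\sum_t (x t : K) * (ky t).1)
      (\sum_t (x t : K) * y t) 0 0 h01.
    rewrite !scaler_suml -big_split /= !scale0r addr0 -{2}x0 combE.
    apply: eq_bigr => t _; have [tL|tL] := boolP (t \in L).
      by rewrite [in RHS]kyE // scalerDr !scalerA.
    by rewrite xL // !mul0r !scale0r addr0.
  move=> t _; have [tL|tL] := boolP (t \in L); first by rewrite cE // scalerA.
  by rewrite xL // mul0r !scale0r.
- move=> f fb; pose P := (f h1 - f h0) * lf (al h1).
  have fP t : t \in L -> (f t - f h0) * lf (al t) = y t *: P.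
    move=> tL; pose x : coefs K T :=
      delta K t - ((ky t).1 *: delta K h0 + y t *: delta K h1).
    have xr : x \in relations al L.
      apply/relationsP; split=> [s sL|]; last first.
        by rewrite linearB linearD !linearZ /= !comb_delta kyE // subrr.
      have nt r : r \in L -> (s == r) = false.
        by move=> rL; apply: contraNF sL => /eqP ->.
      by rewrite !ffunE !nt // !scaler0 addr0 subr0.
    have := fb x xr; pose F s : Sym V := f s * lf (al s).
    have -> : \sum_s (x s : K) *: F s = F t - ((ky t).1 *: F h0 + y t *: F h1).
      rewrite -[F t](sum_delta F) -[F h0](sum_delta F) -[F h1](sum_delta F).
      rewrite !scaler_sumr -big_split -sumrB; apply: eq_bigr => s _.
      by rewrite !ffunE scalerBl scalerDl !scalerA.
    move/eqP; rewrite subr_eq0 /F => /eqP; rewrite mulrBl => ->.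
    rewrite (kyE t) // linearD !linearZ /= /P /y -!mul_mpolyC; ring.
  have [b bE] : divides Q P.
    apply: divides_prod; first exact: enum_uniq.
    move=> t; rewrite mem_enum !inE => /andP[th0 tL].
    have yt : y t != 0.
      apply: contraNneq th0 => yt; apply/eqP/als.2/vlineP; exists (ky t).1.
      by rewrite {1}kyE // -/(y t) yt scale0r addr0.
    exists ((y t)^-1 *: (f t - f h0)).
    by rewrite -scalerAl fP // scalerA mulVf // scale1r.
  exists (f h0), b => t tL; apply: (@addrI _ (- f h0)); rewrite addKr addrC.
  by apply: (mulIf (form_neq0 t)); rewrite fP // bE scalerAr -cE // mulrA.
move=> a b ab0; have := ab0 h0 h0L; rewrite /c eqxx mulr0 addr0 => a0.
have := ab0 h1 h1L; rewrite a0 add0r /c eq_sym (negPf h01) y1 scale1r => /eqP.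
rewrite mulf_eq0 => /orP[/eqP //|]; rewrite prodf_seq_eq0 => /hasP[t _ /=].
by rewrite (negPf (form_neq0 t)).
Qed.

(** It is enough to exhibit a basis indexed by any finite type. *)
Lemma log_free_basis (J : finType) (b : J -> Sym V -> Sym V) :
  (forall j, logarithmic al (b j)) ->
  (forall theta, logarithmic al theta ->
     exists c : J -> Sym V, forall p, theta p = \sum_j c j * b j p) ->
  (forall c : J -> Sym V, (forall p, \sum_j c j * b j p = 0) -> forall j, c j = 0) ->
  log_free al.
Proof.
move=> lb gen indep; exists #|J|, (fun i => b (enum_val i)); split=> // theta lth.
have sumE (c : J -> Sym V) p :
    \sum_(i < #|J|) c (enum_val i) * b (enum_val i) p = \sum_j c j * b j p.
  rewrite [RHS](reindex (fun i : 'I_#|J| => enum_val i)) //.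
  exact/onW_bij/enum_val_bij.
have [c cE] := gen theta lth; exists [ffun i => c (enum_val i)]; split=> [p|d dE].
  by rewrite cE -sumE; apply: eq_bigr => i _; rewrite ffunE.
apply/ffunP => i; rewrite ffunE; pose e j := c j - d (enum_rank j).
have /(_ (enum_val i))/eqP : forall j, e j = 0.
  apply: indep => p; rewrite -sumE; apply/eqP.
  under eq_bigr => k _ do rewrite /e enum_valK mulrBl.
  by rewrite sumrB (sumE c) -cE -dE subrr.
by rewrite /e enum_valK subr_eq0 => /eqP.
Qed.

Hypothesis decomp : lines_decompose al.

Lemma balanced_lines f : (forall L, L \in trips -> balanced (relations al L) f) ->
  balanced (lker comb) f.
Proof.
move=> fb x /(subvP decomp.1)/memv_sumP[r rr ->].
rewrite (eq_bigr (fun t => \sum_(L in trips) (r L t : K) *: (f t * lf (al t)))).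
  by rewrite exchange_big big1 // => L Lt; exact: fb (rr L Lt).
by move=> t _; rewrite sum_ffunE scaler_suml.
Qed.

Let linked := linked al.

Lemma linked_sym : connect_sym linked.
Proof.
apply: sym_connect_sym => s t; apply/existsP/existsP => -[L /and3P[Lt sL tL]].
  by exists L; rewrite Lt sL tL.
by exists L; rewrite Lt sL tL.
Qed.

Lemma root_trip L : L \in trips -> constant_on L (fingraph.root linked).
Proof.
move=> Lt s t sL tL; apply/(fingraph.rootP linked_sym)/connect1/existsP.
by exists L; rewrite Lt sL tL.
Qed.

Let component := {t : T | fingraph.root linked t == t}.

Let comp_of (t : T) : component :=
  exist (fun s => fingraph.root linked s == s) (fingraph.root linked t)
    (introT eqP (fingraph.root_root linked_sym t)).

Let trip := {L : {set T} | L \in trips}.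

(** A derivation that kills the forms al t is determined by its values on a
    complement of their span. *)
Let free_part : {vspace dual V} := ((limg comb)^C)%VS.
Let free_dim := \dim free_part.

Lemma free_part_derivation (j : 'I_free_dim) : exists th,
  [/\ derivation th, forall t, th (lf (al t)) = 0 &
   forall x, th (lf x) =
     (coord (vbasis free_part) j (x - projv (limg comb) x))%:MP].
Proof.
pose v x : Sym V := (coord (vbasis free_part) j (x - projv (limg comb) x))%:MP.
have [|th dth thE] := @derivation_ext K V v.
  move=> k x y; rewrite /v linearP opprD addrACA -scalerBr linearP.
  by rewrite mpolyCD mpolyCM mul_mpolyC.
exists th; split=> // t; rewrite thE /v projv_id ?subrr ?linear0 ?mpolyC0 //.
by rewrite -comb_delta memv_img ?memvf.
Qed.

(** The functions of [acyclic] spread the second basis element of each line over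
    all points, without disturbing the other lines.  Subtracting these from a
    logarithmic derivation makes its quotients by the forms constant on every
    line, hence on every component; what remains after subtracting the
    component indicators kills all forms al t.  The three kinds of derivations
    form a basis. *)
Lemma acyclic_log_free : acyclic K (collinear al) -> log_free al.
Proof.
move/(acyclicP als) => acyc.
have [c cP] := fin_all_exists (fun L : trip => line_module (valP L)).
have g_ (L : trip) (h : T) : exists g : T -> K, h \in val L ->
    (forall M, M \in trips -> M != val L -> constant_on M g) /\
    constant_on (val L) (fun s => g s - (s == h)%:R).
  have [hL|//] := boolP (h \in val L); last by exists (fun=> 0).
  by have [g gP] := acyc (val L) h (valP L) hL; exists g.
have [g gP] := fin_all_exists (fun L => fin_all_exists (g_ L)).
pose G (L : trip) t : Sym V := \sum_(h in val L) (g L h t : K) *: c L h.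
have GM L M : M \in trips -> M != val L -> constant_on M (G L).
  move=> Mt ML s t sM tM; apply: eq_bigr => h hL.
  by have [gM _] := gP L h hL; rewrite (gM M Mt ML s t).
have GL L : constant_on (val L) (fun s => G L s - c L s).
  have GcE s : s \in val L -> G L s - c L s =
      \sum_(h in val L) (g L h s - (s == h)%:R) *: c L h.
    move=> sL; under [in RHS]eq_bigr => h _ do rewrite scalerBl.
    rewrite sumrB; congr (_ - _); rewrite (bigD1 s) //= eqxx scale1r.
    rewrite big1 ?addr0 // => h /andP[_ hs].
    by rewrite eq_sym (negPf hs) scale0r.
  move=> s t sL tL; rewrite !GcE //; apply: eq_bigr => h hL.
  by have [_ gL] := gP L h hL; rewrite (gL s t).
have Gb L : balanced (lker comb) (G L).
  apply: balanced_lines => M Mt; have [ML|ML] := eqVneq M (val L); last first.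
    exact: balanced_const (GM L M Mt ML).
  rewrite ML; have [cb _ _] := cP L.
  apply: (@balanced_eq _ _ (fun t => (G L t - c L t) + 1 * c L t)).
    by move=> t _; rewrite mul1r subrK.
  by apply: balanced_add => //; apply: balanced_const (GL L).
pose I (r : component) t : Sym V := (comp_of t == r)%:R.
have IM r M : M \in trips -> constant_on M (I r).
  move=> Mt s t sM tM; rewrite /I.
  by have -> : comp_of s = comp_of t by apply/val_inj/(root_trip Mt).
have Ib r : balanced (lker comb) (I r).
  by apply: balanced_lines => M Mt; apply: balanced_const (IM r M Mt).
have [thG lG thGE] := fin_all_exists2 (fun L => balanced_derivation (Gb L)).
have [thI lI thIE] := fin_all_exists2 (fun r => balanced_derivation (Ib r)).
have [thF thFP] := fin_all_exists free_part_derivation.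
have lF j : logarithmic al (thF j).
  have [dF F0 _] := thFP j; split=> // t.
  by rewrite F0; exists 0; rewrite mul0r.
pose be (j : 'I_free_dim) : dual V := (vbasis free_part)`_j.
have beF j : be j \in free_part by rewrite vbasis_mem // mem_nth ?size_tuple.
have thFbe j i : thF j (lf (be i)) = (i == j)%:R.
  have [_ _ ->] := thFP j.
  have /eqP -> : projv (limg comb) (be i) == 0 by rewrite -memv_ker lker_proj.
  by rewrite subr0 coord_free ?(basis_free (vbasisP _)) // -mpolyC_nat.
pose J := (trip + component + 'I_free_dim)%type.
pose b (j : J) := match j with
  | inl (inl L) => thG L | inl (inr r) => thI r | inr k => thF k end.
have sumJ (F : J -> Sym V) : \sum_j F j =
    \sum_L F (inl (inl L)) + \sum_r F (inl (inr r)) + \sum_k F (inr k).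
  by rewrite !big_sumType.
apply: (@log_free_basis J b); first by
    case=> [[L|r]|k]; [apply: lG | apply: lI | apply: lF].
  move=> theta lth; have [dth lth2] := lth; have [q qE] := fin_all_exists lth2.
  have qb := logarithmic_balanced dth qE.
  have ab_ (L : trip) : exists ab, forall t, t \in val L -> q t = ab.1 + ab.2 * c L t.
    have [_ cgen _] := cP L; have [|a [d ad]] := cgen q; last by exists (a, d).
    by move=> x xr; apply: qb; apply: (subvP (capvSr _ _)) xr.
  have [ab abE] := fin_all_exists ab_.
  pose f t := q t - \sum_L (ab L).2 * G L t.
  have fM M : M \in trips -> constant_on M f.
    move=> Mt s t sM tM; pose L : trip := exist _ M Mt.
    have fL x : f x = (q x - (ab L).2 * G L x) - \sum_(L' | L' != L) (ab L').2 * G L' x.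
      by rewrite /f (bigD1 L) //= opprD addrA.
    rewrite !fL; congr (_ - _); last first.
      apply: eq_bigr => L' LL'; congr (_ * _); apply: (GM _ M) => //.
      by apply: contraNneq LL' => ML; apply/eqP/val_inj; rewrite /= -ML.
    rewrite !(abE L) // -!addrA -!mulrBr; congr (_ + _ * _).
    by apply: oppr_inj; rewrite !opprB; apply: (GL L).
  have fE t : f t = f (fingraph.root linked t).
    exact: constant_connect fM (connect_root _ _).
  pose th' p := (-1) * (\sum_L (ab L).2 * thG L p) +
    ((-1) * (\sum_(r : component) f (val r) * thI r p) + theta p).
  have dth' : derivation th'.
    apply: derivation_mul_add; first by apply: derivation_sum => L; case: (lG L).
    apply: derivation_mul_add => //.
    by apply: derivation_sum => r; case: (lI r).
  have th'0 t : th' (lf (al t)) = 0.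
    rewrite /th' qE.
    have -> : \sum_L (ab L).2 * thG L (lf (al t)) =
        (\sum_L (ab L).2 * G L t) * lf (al t).
      by rewrite mulr_suml; apply: eq_bigr => L _; rewrite thGE mulrA.
    have -> : \sum_(r : component) f (val r) * thI r (lf (al t)) = f t * lf (al t).
      rewrite (bigD1 (comp_of t)) //= big1 ?addr0.
        by rewrite thIE /I eqxx mul1r -fE.
      by move=> r rt; rewrite thIE /I eq_sym (negPf rt) mul0r mulr0.
    by rewrite /f; ring.
  pose thL := GRing.isLinear.Build K _ _ _ _ (derivation_linear dth').
  pose th'f : {linear dual V -> Sym V} := HB.pack (fun x => th' (lf x)) thL.
  have th'U u : u \in limg comb -> th'f u = 0.
    case/memv_imgP => d _ ->; rewrite combE linear_sum big1 // => t _.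
    by rewrite linearZ /= th'0 scaler0.
  have th'E : forall p, th' p = \sum_k th' (lf (be k)) * thF k p.
    apply: derivation_eq => //; first by apply: derivation_sum => k; case: (thFP k).
    move=> x; rewrite -[LHS]/(th'f x) -{1}(subrK (projv (limg comb) x) x).
    rewrite linearD (th'U (projv _ _)) ?memv_proj // addr0.
    have xF : x - projv (limg comb) x \in free_part by apply: memv_projC.
    rewrite {1}(coord_vbasis xF) linear_sum; apply: eq_bigr => k _.
    by have [_ _ ->] := thFP k; rewrite linearZ /= mulrC mul_mpolyC.
  exists (fun j => match j with
    | inl (inl L) => (ab L).2 | inl (inr r) => f (val r)
    | inr k => th' (lf (be k)) end).
  by move=> p; rewrite sumJ /= -th'E /th'; ring.
move=> C C0; pose f t := \sum_L C (inl (inl L)) * G L t + \sum_r C (inl (inr r)) * I r t.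
have f0 t : f t = 0.
  apply: (mulIf (form_neq0 t)); rewrite mul0r -[RHS](C0 (lf (al t))) sumJ /=.
  rewrite [X in _ + X]big1 ?addr0.
    rewrite mulrDl !mulr_suml; congr (_ + _); apply: eq_bigr => j _.
      by rewrite thGE mulrA.
    by rewrite thIE mulrA.
  by move=> k _; have [_ -> _] := thFP k; rewrite mulr0.
have CL L : C (inl (inl L)) = 0.
  have [_ _ cU] := cP L.
  have [L0|[s sL]] := set_0Vmem (val L).
    by have := trip_card (valP L); rewrite L0 cards0.
  have frest : constant_on (val L) (fun t =>
     \sum_(L' | L' != L) C (inl (inl L')) * G L' t + \sum_r C (inl (inr r)) * I r t).
    move=> x y xL yL; congr (_ + _); apply: eq_bigr => j jL; congr (_ * _).
      apply: (GM _ (val L)) => //; first exact: valP.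
      by apply: contraNneq jL => LE; apply/eqP/val_inj.
    exact: IM (valP L) _ _ xL yL.
  pose k := C (inl (inl L)) * (G L s - c L s) +
    (\sum_(L' | L' != L) C (inl (inl L')) * G L' s + \sum_r C (inl (inr r)) * I r s).
  apply: (cU k) => t tL; rewrite -[RHS](f0 t) /f (bigD1 L) //= /k (GL L s t) //.
  by rewrite (frest s t) //; ring.
have CI r : C (inl (inr r)) = 0.
  have := f0 (val r); rewrite /f big1 ?add0r; last by move=> L _; rewrite CL mul0r.
  rewrite (bigD1 r) //= /I.
  have -> : comp_of (val r) = r by apply/val_inj/eqP/(valP r).
  rewrite eqxx mulr1 big1 ?addr0 // => r' r'r; rewrite eq_sym (negPf r'r) mulr0 //.
case=> [[L|r]|k]; rewrite ?CL ?CI //.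
have := C0 (lf (be k)); rewrite sumJ /=.
rewrite big1 ?add0r; last by move=> L _; rewrite CL mul0r.
rewrite big1 ?add0r; last by move=> r _; rewrite CI mul0r.
rewrite (bigD1 k) //= thFbe eqxx mulr1 big1 ?addr0 // => i ik.
by rewrite thFbe eq_sym (negPf ik) mulr0.
Qed.

End AcyclicImpliesFree.

(** * Flats as sets of points *)
Section Annihilators.
Variables (K : fieldType) (V : vectType K).

Lemma form_value1 (U : {vspace V}) (b : dual V) : ~~ (U <= lker b)%VS ->
  exists2 u, u \in U & b u = 1.
Proof.
case/subvPn => u uU; rewrite memv_ker => bu.
exists ((b u : K)^-1 *: u); first exact: memvZ.
by rewrite linearZ /= /GRing.scale /= mulVf.
Qed.

(** Duality between subspaces of V^* and of V: by induction on the forms,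
    correcting b by a multiple of a to make it vanish on the common kernel of
    the remaining ones. *)
Lemma bigcap_ker_sub (r : seq (dual V)) (b : dual V) :
  ((\bigcap_(a <- r) lker a) <= lker b)%VS = (b \in (\sum_(a <- r) <[a]>)%VS).
Proof.
apply/idP/idP; last first.
  elim: r b => [|a r IH] b.
    rewrite !big_nil memv0 => /eqP ->; apply/subvP => v _.
    by rewrite memv_ker zero_lfunE.
  rewrite !big_cons => /memv_addP[_ /vlineP[k ->] [d /IH dr ->]].
  apply/subvP => v; rewrite memv_cap !memv_ker => /andP[/eqP av /(subvP dr)].
  by rewrite memv_ker => /eqP dv; rewrite add_lfunE scale_lfunE av dv scaler0 addr0.
elim: r b => [|a r IH] b.
  rewrite !big_nil => /subvP b0; rewrite memv0; apply/eqP/lfunP => v.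
  by have := b0 v (memvf v); rewrite memv_ker zero_lfunE => /eqP.
rewrite !big_cons; set W := (\bigcap_(c <- r) lker c)%VS => Wb.
have [Wa|nWa] := boolP (W <= lker a)%VS.
  apply: (subvP (addvSr _ _)); apply: IH; apply: subv_trans Wb.
  by rewrite subv_cap Wa subvv.
have [u uW au] := form_value1 nWa.
rewrite -(subrK ((b u : K) *: a) b) addrC.
apply: memv_add; first by rewrite memvZ ?memv_line.
apply: IH; apply/subvP => v vW; rewrite memv_ker add_lfunE opp_lfunE scale_lfunE.
have : v - (a v : K) *: u \in (lker a :&: W)%VS.
  apply/memv_capP; split; last by rewrite memvB ?memvZ.
  by rewrite memv_ker linearB linearZ /= au /GRing.scale /= mulr1 subrr.
move/(subvP Wb); rewrite memv_ker linearB linearZ /= /GRing.scale /=.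
by rewrite mulrC.
Qed.

Lemma dim_bigcap_ker (r : seq (dual V)) :
  (\dim (\bigcap_(a <- r) lker a) + \dim (\sum_(a <- r) <[a]>))%N = \dim {:V}.
Proof.
elim: r => [|a r IH]; first by rewrite !big_nil dimv0 addn0.
rewrite !big_cons; set W := (\bigcap_(c <- r) lker c)%VS in IH *.
set S := (\sum_(c <- r) <[c]>)%VS in IH *.
have [aS|naS] := boolP (a \in S).
  have /capv_idPr -> : (W <= lker a)%VS by rewrite bigcap_ker_sub.
  by have /addv_idPr -> : (<[a]> <= S)%VS by rewrite -memvE.
have nWa : ~~ (W <= lker a)%VS by rewrite bigcap_ker_sub.
have a0 : a != 0 by apply: contraNneq naS => ->; rewrite mem0v.
rewrite dimv_disjoint_sum; last first.
  apply/eqP; rewrite -subv0; apply/subvP => v; rewrite memv_cap => /andP[/vlineP[k ->]].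
  rewrite memv0 scaler_eq0 (negPf a0) orbF; apply: contraLR => k0.
  by apply: contra naS => kS; rewrite -[a](scalerK k0) memvZ.
rewrite dim_vline a0 -IH addnA; congr (_ + _)%N.
rewrite -(limg_ker_dim a W) capvC; congr (_ + _)%N; apply/esym/eqP.
rewrite eqn_leq; apply/andP; split.
  by apply: (leq_trans (dimvS (subvf _))); rewrite dimvf.
rewrite lt0n dimv_eq0; have [u uW au] := form_value1 nWa.
apply: contraTneq (memv_img a uW) => ->; rewrite au memv0; exact: oner_neq0.
Qed.
End Annihilators.

Section Dictionary.
Variables (K : fieldType) (V : vectType K) (A : {fset {vspace V}}).
Hypothesis hA : arrangement A.

Lemma equation_exists (H : A) : exists a : dual V, (a != 0) && (val H == lker a).
Proof. by have [a a0 ->] := hA (valP H); exists a; rewrite a0 eqxx. Qed.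

(** A choice of alpha_H; all the conditions considered are invariant under
    scaling it. *)
Definition equation (H : A) : dual V := xchoose (equation_exists H).

Lemma equation_neq0 H : equation H != 0.
Proof. by case/andP: (xchooseP (equation_exists H)). Qed.

Lemma lker_equation H : lker (equation H) = val H.
Proof. by case/andP: (xchooseP (equation_exists H)) => _ /eqP. Qed.

Lemma sub_lker (a b : dual V) : (lker a <= lker b)%VS = (b \in <[a]>%VS).
Proof. by have := bigcap_ker_sub [:: a] b; rewrite !big_seq1. Qed.

Lemma dim_lker (a : dual V) : (\dim (lker a) + (a != 0%R))%N = \dim {:V}.
Proof. by have := dim_bigcap_ker [:: a]; rewrite !big_seq1 dim_vline. Qed.

Lemma hyperplane_sub (H H' : A) : (val H <= val H')%VS -> H = H'.
Proof.
move=> sub; apply/val_inj/eqP; rewrite eqEdim sub /=.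
have := dim_lker (equation H); have := dim_lker (equation H').
by rewrite !equation_neq0 !lker_equation => <- /eqP; rewrite eqn_add2r => /eqP ->.
Qed.

Lemma equation_simple : simple equation.
Proof.
split=> [|H H']; first exact: equation_neq0.
by rewrite -sub_lker !lker_equation => /hyperplane_sub.
Qed.

Lemma sub_centerP (B : {fset {vspace V}}) X :
  reflect (forall H, H \in B -> (X <= H)%VS) (X <= center B)%VS.
Proof.
rewrite /center; apply: (iffP idP) => [XB H HB|XB].
  by apply: subv_trans XB _; rewrite (big_fsetD1 H) //= capvSl.
rewrite big_seq; elim/big_ind: _ => //; first exact: subvf.
by move=> U W XU XW; rewrite subv_cap XU.
Qed.

Lemma center_le (B : {fset {vspace V}}) H : H \in B -> (center B <= H)%VS.
Proof. exact: (elimT (sub_centerP _ _) (subvv _)). Qed.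

Lemma center_pair (H H' : {vspace V}) : center [fset H; H']%fset = (H :&: H')%VS.
Proof.
apply/eqP; rewrite eqEsubv; apply/andP; split.
  by rewrite subv_cap !center_le // in_fset2 eqxx ?orbT.
by apply/sub_centerP => G; rewrite in_fset2 => /orP[] /eqP ->; rewrite (capvSl, capvSr).
Qed.

Lemma pair_sub (a b : A) : ([fset val a; val b] `<=` A)%fset.
Proof. by apply/fsubsetP => H; rewrite in_fset2 => /orP[] /eqP ->; apply: valP. Qed.

Definition points (X : {vspace V}) : {set A} := [set H : A | (X <= val H)%VS].

Lemma center_forms (B : {fset {vspace V}}) : (B `<=` A)%fset ->
  center B = (\bigcap_(a <- [seq equation H |
    H <- enum [set H : A | val H \in B]]) lker a)%VS.
Proof.
move=> BA; apply/eqP; rewrite eqEsubv; apply/andP; split.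
  rewrite big_map big_enum; apply/subv_bigcapP => H; rewrite inE => HB.
  by rewrite lker_equation; apply/sub_centerP: HB.
apply/sub_centerP => H HB; have HA : H \in A by apply: (fsubsetP BA).
rewrite big_map big_enum; apply: (@bigcapv_inf _ _ _ [` HA]%fset).
  by rewrite inE.
by rewrite lker_equation.
Qed.

Lemma spanned_forms (S : {set A}) :
  spanned equation S = (\sum_(a <- [seq equation H | H <- enum S]) <[a]>)%VS.
Proof. by rewrite big_map big_enum. Qed.

Lemma center_sub (B : {fset {vspace V}}) b : (B `<=` A)%fset ->
  (center B <= lker b)%VS = (b \in spanned equation [set H : A | val H \in B]).
Proof. by move=> BA; rewrite (center_forms BA) bigcap_ker_sub spanned_forms. Qed.

Lemma codim_center (B : {fset {vspace V}}) : (B `<=` A)%fset ->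
  codim (center B) = \dim (spanned equation [set H : A | val H \in B]).
Proof.
move=> BA; rewrite /codim (center_forms BA) spanned_forms.
by rewrite -(dim_bigcap_ker [seq equation H | H <- enum [set H : A | val H \in B]]) addKn.
Qed.

Lemma localization_sub X : (localization A X `<=` A)%fset.
Proof. exact: fset_sub. Qed.

Lemma mem_localization X H : (H \in localization A X) = (H \in A) && (X <= H)%VS.
Proof. by rewrite !inE. Qed.

Lemma latticeP X :
  reflect (X = center (localization A X)) (X \in lattice A).
Proof.
rewrite /lattice; apply: (iffP (imfsetP _ _ _ _)) => [[B /= BA ->]|XE].
  rewrite fpowersetE in BA; apply/eqP; rewrite eqEsubv; apply/andP; split.
    by apply/sub_centerP => H; rewrite mem_localization => /andP[].
  apply/sub_centerP => H HB; apply: center_le.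
  rewrite mem_localization (fsubsetP BA) //=.
  exact: center_le.
by exists (localization A X); rewrite //= fpowersetE localization_sub.
Qed.

Lemma points_localization X : [set H : A | val H \in localization A X] = points X.
Proof. by apply/setP => H; rewrite !inE (valP H). Qed.

Lemma center_lattice B : (B `<=` A)%fset -> center B \in lattice A.
Proof. by move=> BA; rewrite /lattice; apply/imfsetP; exists B; rewrite //= fpowersetE. Qed.

Lemma lattice_codim X : X \in lattice A -> codim X = \dim (spanned equation (points X)).
Proof.
by move/latticeP => XE; rewrite {1}XE codim_center ?localization_sub // points_localization.
Qed.

Lemma points_inj : {in lattice A &, injective points}.
Proof.
move=> X Y /latticeP XE /latticeP YE XY; rewrite XE YE; congr center.
apply/fsetP => H; rewrite !mem_localization; case: (boolP (H \in A)) => //= HA.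
by move/setP/(_ [` HA]%fset): XY; rewrite !inE.
Qed.

Lemma center_localization : localization A (center A) = A.
Proof.
apply/fsetP => H; rewrite mem_localization andb_idr // => HA.
exact: center_le.
Qed.

Lemma points_center : points (center A) = setT.
Proof.
apply/setP => H; rewrite !inE.
exact: center_le (valP H).
Qed.

Lemma rankE : rank A = \dim (spanned equation setT).
Proof.
rewrite /rank codim_center ?fsubset_refl //; congr (\dim (spanned _ _)).
by apply/setP => H; rewrite !inE (valP H).
Qed.

Lemma card_localization X : #|` localization A X| = #|points X|.
Proof.
have -> : localization A X = [fset val H | H in points X]%fset.
  apply/fsetP => H; rewrite mem_localization; apply/andP/imfsetP => /=.
    by case=> HA XH; exists [` HA]%fset; rewrite // inE.
  by case=> G; rewrite inE => XG ->; rewrite (valP G).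
rewrite card_imfset; last exact: val_inj.
by rewrite /= -cardE.
Qed.

Lemma line_flat (a b : A) : a != b -> [/\ (val a :&: val b)%VS \in lattice A,
     points (val a :&: val b)%VS = line equation a b & codim (val a :&: val b)%VS = 2%N].
Proof.
move=> ab; have BA := pair_sub a b; rewrite -center_pair.
have SE : [set H : A | val H \in [fset val a; val b]%fset] = [set a; b].
  by apply/setP => H; rewrite in_set in_fset2 in_set2 -!(inj_eq val_inj).
have sE : spanned equation [set a; b] = plane equation a b.
  by rewrite /spanned big_setU1 ?inE //= big_set1.
split; first exact: center_lattice.
  by apply/setP => c; rewrite !in_set -(lker_equation c) center_sub // SE sE.
by rewrite codim_center // SE sE dim_plane //; apply: equation_simple.
Qed.

Lemma flats2P X :
  reflect (exists a b : A, a != b /\ X = (val a :&: val b)%VS) (X \in flats 2 A).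
Proof.
rewrite inE /= inE /=; apply: (iffP andP) => [[XL /eqP X2]|[a [b [ab ->]]]]; last first.
  by have [L _ ->] := line_flat ab; rewrite L.
have [/existsP[a /andP[aX /existsP[b /andP[bX ab]]]]|] :=
    boolP [exists a, (a \in points X) && [exists b, (b \in points X) && (a != b)]].
  exists a, b; split=> //; rewrite !inE in aX bX.
  have [L _ c2] := line_flat ab.
  have sub : (X <= val a :&: val b)%VS by rewrite subv_cap aX.
  apply/eqP; rewrite eqEdim sub; rewrite /codim in X2 c2.
  have := dimvS (subvf X); have := dimvS (subvf (val a :&: val b)%VS).
  move: X2 c2; set d := \dim fullv; set x := \dim X; set y := \dim _.
  by move=> X2 c2 yd xd; rewrite -(subKn yd) c2 -X2 (subKn xd) /= leqnn.
move=> nab; move: X2; rewrite lattice_codim // => X2.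
have [X0|[a aX]] := set_0Vmem (points X).
  by move: X2; rewrite X0 /spanned big_set0 dimv0.
have /dimvS : (spanned equation (points X) <= <[equation a]>)%VS.
  apply/spannedP => b bX; have [->|ba] := eqVneq b a; first exact: memv_line.
  case/negP: nab; apply/existsP; exists b; rewrite bX; apply/existsP; exists a.
  by rewrite aX.
by rewrite X2 dim_vline; case: (_ != _).
Qed.

Lemma mem_flats k X : (X \in flats k A) = (X \in lattice A) && (codim X == k).
Proof. by rewrite /flats in_fset inE. Qed.

Lemma mem_triple_flats X :
  (X \in triple_flats A) = (X \in flats 2 A) && (2 < #|points X|)%N.
Proof. by rewrite /triple_flats in_fset inE /= card_localization. Qed.

(** A flat is determined by its points, so that sums over the flats of rank 2
    become sums over lines. *)
Lemma trips_flats : perm_eq [seq points X | X <- triple_flats A] (enum (trips equation)).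
Proof.
apply: uniq_perm; [|exact: enum_uniq|].
  rewrite map_inj_in_uniq ?fset_uniq // => X Y.
  rewrite !mem_triple_flats !mem_flats => /andP[/andP[XL _] _].
  by move=> /andP[/andP[YL _] _]; apply: points_inj.
move=> L; rewrite mem_enum; apply/mapP/tripsP.
  case=> X; rewrite mem_triple_flats => /andP[X2 X3 ->].
  have [a [b [ab XE]]] := flats2P X X2; exists a, b; split=> //.
  by have [_ <- _] := line_flat ab; rewrite XE.
case=> a [b [ab LE L3]]; have [XL XE X2] := line_flat ab.
exists (val a :&: val b)%VS; last by rewrite XE.
rewrite mem_triple_flats XE -LE L3 andbT.
by apply/flats2P; exists a, b.
Qed.

Lemma sum_trips (R : Type) (idx : R) (op : Monoid.com_law idx) (F : nat -> R) :
  \big[op/idx]_(X <- triple_flats A) F #|` localization A X|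
  = \big[op/idx]_(L in trips equation) F #|L|.
Proof.
rewrite -[RHS]big_enum -(perm_big _ trips_flats) big_map.
by apply: eq_bigr => X _; rewrite card_localization.
Qed.

Lemma card_trips : #|` triple_flats A| = #|trips equation|.
Proof. by rewrite cardE -(perm_size trips_flats) size_map. Qed.

Lemma card_arrangement : #|` A| = #|{: A}|.
Proof. exact: cardfE. Qed.
End Dictionary.

(** * The relation spaces of the formality conditions *)
Section FlatSums.
Variables (K : fieldType) (V : vectType K) (F : {fset {vspace V}}).

Lemma fam_sumE (E : vectType K) (f : {ffun F -> E}) : fam_sum F E f = \sum_i f i.
Proof. by rewrite lfunE. Qed.

Lemma fam_inE (E : vectType K) (i : F) (v : E) j :
  fam_in E i v j = if j == i then v else 0.
Proof. by rewrite lfunE ffunE. Qed.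

Lemma flat_sumP (E : vectType K) k B (W : {vspace V} -> {vspace E})
    (f : {ffun F -> E}) :
  reflect ((forall i, val i \in flats k B -> f i \in W (val i)) /\
           (forall i, val i \notin flats k B -> f i = 0))
          (f \in flat_sum F k B W).
Proof.
apply: (iffP idP) => [/memv_sumP[v vW ->]|[fW f0]].
  split=> i iB; rewrite sum_ffunE.
    rewrite (bigD1 i) //= big1 ?addr0.
      by have /memv_imgP[u uW ->] := vW i iB; rewrite fam_inE eqxx.
    move=> j /andP[jB ji]; have /memv_imgP[u _ ->] := vW j jB.
    by rewrite fam_inE eq_sym (negPf ji).
  rewrite big1 // => j jB; have /memv_imgP[u _ ->] := vW j jB.
  by rewrite fam_inE; case: eqP iB => // ->; rewrite jB.
have -> : f = \sum_(i : F | val i \in flats k B) fam_in E i (f i).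
  apply/ffunP => j; rewrite sum_ffunE.
  have [jB|/[dup] jB /f0 fj] := boolP (val j \in flats k B).
    rewrite (bigD1 j) //= fam_inE eqxx big1 ?addr0 // => i /andP[_ ij].
    by rewrite fam_inE eq_sym (negPf ij).
  rewrite fj big1 // => i iB; rewrite fam_inE; case: eqP iB => // <-.
  by rewrite (negPf jB).
by apply: memv_sumr => i iB; apply: memv_img; apply: fW.
Qed.

Lemma relS0E B (a : dual V) : (a \in relS F 0 B) = (center B <= lker a)%VS.
Proof.
rewrite /= memv_ker lfunE /=; apply/eqP/subvP => [a0 v vB|ka].
  have := congr1 (fun g : dual (subvs_of (center B)) => g (vsproj _ v)) a0.
  by rewrite comp_lfunE lfunE /= vsprojK // zero_lfunE memv_ker => ->.
apply/lfunP => u; rewrite comp_lfunE lfunE /= zero_lfunE; apply/eqP.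
by rewrite -memv_ker; apply: ka; apply: subvsP.
Qed.
End FlatSums.

Section Decomposition.
Variables (K : fieldType) (V : vectType K) (A : {fset {vspace V}}).
Hypothesis hA : arrangement A.
Let F := lattice A.
Local Notation eqn := (equation hA).

(** The flats of rank 1 are the hyperplanes, so that the first relation space
    is made of families of multiples of the forms. *)
Lemma flats1E X H : (H \in flats 1 (localization A X)) = (H \in localization A X).
Proof.
have sub := @localization_sub _ _ A X.
have hX : arrangement (localization A X) by move=> G /(fsubsetP sub); apply: hA.
rewrite (mem_flats); apply/andP/idP => [[HL /eqP H1]|HX].
  rewrite (lattice_codim hX HL) in H1.
  have [P0|[G GP]] := set_0Vmem (points (localization A X) H).
    by move: H1; rewrite P0 /spanned big_set0 dimv0.
  suff -> : H = val G by apply: valP.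
  move: GP; rewrite inE => HG; apply/eqP; rewrite eqEdim HG /=.
  have H1' : codim H = 1%N by rewrite (lattice_codim hX HL).
  have := dim_lker (equation hX G); rewrite lker_equation (equation_neq0 hX) => dG.
  have := dimvS (subvf H); move: H1'; rewrite /codim => H1' le.
  by rewrite -(leq_add2r 1) dG -{1}(subnK le) H1' addnC.
pose B := [fset H]%fset; have BX : (B `<=` localization A X)%fset by rewrite fsub1set.
have HE : H = center B.
  apply/eqP; rewrite eqEsubv; apply/andP; split.
    by apply/sub_centerP => G; rewrite inE => /eqP ->.
  by apply: center_le; rewrite inE.
have HX' : H = val ([` HX]%fset : localization A X) by [].
split; first by rewrite HE; apply: center_lattice.
rewrite /codim HX' -(lker_equation hX) -(dim_lker (equation hX [` HX]%fset)).
by rewrite (equation_neq0 hX) addKn.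
Qed.

Lemma hyperplane_lattice (H : A) : val H \in F.
Proof.
have := flats1E (center A) (val H); rewrite center_localization (valP H).
by rewrite mem_flats => /andP[].
Qed.

Lemma center_localization_hyperplane X (H : A) : val H \in localization A X ->
  localization (localization A X) (val H) = [fset val H]%fset.
Proof.
rewrite mem_localization => /andP[HA XH]; apply/fsetP => G; rewrite mem_localization inE.
rewrite mem_localization; apply/idP/eqP => [/andP[/andP[GA _] HG]|->].
  by have := @hyperplane_sub _ _ _ hA H [` GA]%fset HG => ->.
by rewrite HA XH subvv.
Qed.

(** The embedding of coefficient vectors in the first relation space, which
    consists of families of forms indexed by flats. *)
Definition family_fun (c : coefs K A) : {ffun F -> dual V} :=
  [ffun i => \sum_(H : A | val H == val i) (c H : K) *: eqn H].

Fact family_is_linear : linear family_fun.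
Proof.
move=> k c d; apply/ffunP => i; rewrite !ffunE scaler_sumr -big_split /=.
by apply: eq_bigr => H _; rewrite !ffunE scalerDl scalerA.
Qed.
HB.instance Definition _ :=
  GRing.isLinear.Build K (coefs K A) {ffun F -> dual V} _ family_fun
    family_is_linear.

Definition flat_of (H : A) : F := [` hyperplane_lattice H]%fset.

Lemma family_hyperplane c (H : A) : family_fun c (flat_of H) = (c H : K) *: eqn H.
Proof.
rewrite ffunE (bigD1 H) //= big1 ?addr0 // => G /andP[GH].
by rewrite -(inj_eq val_inj) GH.
Qed.

Lemma family_inj : injective family_fun.
Proof.
move=> c d cd; apply/ffunP => H; have := family_hyperplane c H.
rewrite cd family_hyperplane => /eqP; rewrite -subr_eq0 -scalerBl scaler_eq0.
by rewrite (negPf (equation_neq0 hA H)) orbF subr_eq0 eq_sym => /eqP.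
Qed.

Lemma family_sum c : \sum_i family_fun c i = comb eqn c.
Proof.
rewrite combE [LHS](eq_bigr (fun i : F =>
  \sum_(H : A | val H == val i) (c H : K) *: eqn H)); last first.
  by move=> i _; rewrite ffunE.
rewrite (exchange_big_dep predT) //=; apply: eq_bigr => H _.
rewrite (bigD1 (flat_of H)) //= big1 ?addr0 // => i /andP[/eqP Hi].
by rewrite -(inj_eq val_inj) /= Hi eqxx.
Qed.

(** R_2 of a localization is the space of relations among its forms. *)
Lemma relS1P X (f : {ffun F -> dual V}) :
  reflect (exists2 c, c \in relations eqn (points A X) & f = family_fun c)
          (f \in relS F 1 (localization A X)).
Proof.
have HX (H : A) : (val H \in localization A X) = (H \in points A X).
  by rewrite mem_localization inE (valP H).
rewrite [relS _ _ _]/= memv_cap memv_ker fam_sumE; apply: (iffP andP).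
  case=> /eqP f0 /flat_sumP[fP fN].
  have c_ (H : A) : exists k : K, f (flat_of H) = k *: eqn H /\
     (H \notin points A X -> k = 0).
    have [HP|HP] := boolP (H \in points A X); last first.
      by exists 0; rewrite fN ?scale0r // flats1E HX.
    have : f (flat_of H) \in relS F 0 (localization (localization A X) (val H)).
      by apply: (fP (flat_of H)); rewrite flats1E HX.
    rewrite (relS0E F) center_localization_hyperplane ?HX //.
    have -> : center [fset val H]%fset = val H by rewrite /center big_seq_fset1.
    by rewrite -(lker_equation hA) sub_lker => /vlineP[k ->]; exists k.
  have [c cP] := fin_all_exists c_.
  have fE : f = family_fun [ffun H => c H].
    apply/ffunP => i; have [iA|iA] := boolP (val i \in A).
      have -> : i = flat_of [` iA]%fset by apply/val_inj.
      by rewrite family_hyperplane ffunE; case: (cP [` iA]%fset).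
    rewrite fN ?ffunE ?big1 //.
      by move=> H /eqP HE; case/negP: iA; rewrite -HE; apply: valP.
    by rewrite flats1E mem_localization (negPf iA).
  exists [ffun H => c H] => //.
  apply/relationsP; split=> [H HP|]; first by rewrite ffunE; case: (cP H) => _ ->.
  by rewrite -family_sum -fE.
case=> c /relationsP[cX c0] ->; rewrite family_sum c0; split=> //.
apply/flat_sumP; split=> i; rewrite flats1E => iX.
  have iA : val i \in A by move: iX; rewrite mem_localization => /andP[].
  have -> : i = flat_of [` iA]%fset by apply/val_inj.
  rewrite family_hyperplane (relS0E F).
  have -> : localization (localization A X) (val (flat_of [` iA]%fset)) =
      [fset val i]%fset.
    exact: (@center_localization_hyperplane X [` iA]%fset iX).
  have -> : center [fset val i]%fset = lker (eqn [` iA]%fset).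
    by rewrite lker_equation /center big_seq_fset1.
  by rewrite sub_lker memvZ ?memv_line.
rewrite ffunE big1 // => H /eqP HE; rewrite cX ?scale0r // -HX HE //.
Qed.

Hypothesis TF : TF2 A.
Local Notation trips := (trips eqn).

Lemma center_lattice_self : center A \in F.
Proof. exact: center_lattice. Qed.

(** In rank at most 2 there is at most one line, which carries all relations. *)
Lemma lines_decompose_small : (rank A <= 2)%N -> lines_decompose eqn.
Proof.
rewrite (rankE hA) => r2; have als := equation_simple hA.
have lineT a b : a != b -> line eqn a b = setT.
  move=> ab; apply/setP => c; rewrite !inE /collinear.
  have -> : plane eqn a b = spanned eqn setT; last by rewrite mem_spanned ?inE.
  apply/eqP; rewrite eqEdim dim_plane // r2 andbT -line_spanned //.
  exact/spannedS/subsetT.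
have tripT L : L \in trips -> L = setT by case/tripsP => a [b [ab -> _]]; apply: lineT.
split; last first.
  apply/directv_sum_independent => us usR us0 L Lt.
  move: us0; rewrite (bigD1 L) //= big1 ?addr0 // => M /andP[Mt].
  by rewrite (tripT M Mt) (tripT L Lt) eqxx.
apply/subvP => c; rewrite memv_ker => /eqP c0.
have cT : c \in relations eqn setT by apply/relationsP; split=> // t; rewrite inE.
have [/existsP[a /existsP[b ab]]|nab] := boolP [exists a : A, [exists b, a != b]].
  have [Tt|nT] := boolP (setT \in trips).
    by apply: (subvP (sumv_sup _ Tt (subvv _))).
  move: cT nT; rewrite -(lineT a b ab) => cT nT; move: cT.
  by rewrite relations_pair // memv0 => /eqP ->; rewrite mem0v.
suff -> : c = 0 by apply: mem0v.
apply/ffunP => t; rewrite [RHS]ffunE; move: c0; rewrite combE (bigD1 t) //= big1 ?addr0.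
  by move/eqP; rewrite scaler_eq0 (negPf (equation_neq0 hA t)) orbF => /eqP.
move=> s st; case/existsP: nab; exists s; apply/existsP; by exists t.
Qed.

(** In rank at least 3, R_3 is the image of a sum of spaces that vanish, hence
    is zero; as R_3 is the kernel of pi_2, this is the independence of the
    lines.  Generation is the surjectivity of pi_2. *)
Theorem TF2_decompose : lines_decompose eqn.
Proof.
have [r2|r3] := leqP (rank A) 2; first exact: lines_decompose_small.
have als := equation_simple hA; have [tf vanish] := TF.
have f3 : formal F A 3.
  by have := tf (center A) center_lattice_self 3%N; rewrite center_localization; apply.
have [p1 p2] : pi_surjective F 1 A /\ pi_surjective F 2 A.
  split; last by inversion f3.
  by inversion f3; inversion H1 => //; subst.
have rel2 : relS F 2 A = 0%VS.
  rewrite -p2; apply/eqP; rewrite -subv0; apply/subvP => g /memv_imgP[f].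
  case/flat_sumP=> fP fN ->; rewrite memv0 fam_sumE big1 // => i _.
  have [iL|/fN //] := boolP (val i \in flats 3 A).
  by apply/eqP; rewrite -memv0 -(vanish 3%N isT _ iL); apply: fP.
have relT : relations eqn setT = lker (comb eqn).
  apply/capv_idPr/subvP => c _; apply/supportedP => t; by rewrite inE.
split.
  apply/subvP => c cr.
  have : family_fun c \in relS F 1 A.
    suff: family_fun c \in relS F 1 (localization A (center A)).
      by rewrite center_localization.
    by apply/relS1P; exists c => //; rewrite points_center relT.
  rewrite -p1 => /memv_imgP[f /flat_sumP[fP fN] cE].
  have r_ (i : F) : exists r : coefs K A, f i = family_fun r /\
      (r \in \sum_(L in trips) relations eqn L)%VS.
    have [i2|/fN ->] := boolP (val i \in flats 2 A); last first.
      by exists 0; rewrite linear0 mem0v.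
    have /relS1P[r rr ->] := fP i i2; exists r; split=> //.
    have [a [b [ab iE]]] := flats2P hA (val i) i2.
    have [_ PE _] := line_flat hA ab; move: rr; rewrite iE PE => rr.
    have [Lt|nL] := boolP (line eqn a b \in trips).
      by apply: (subvP (sumv_sup _ Lt (subvv _))).
    by move: rr; rewrite relations_pair // memv0 => /eqP ->; rewrite mem0v.
  have [r rP] := fin_all_exists r_.
  have -> : c = \sum_i r i.
    apply: family_inj; rewrite cE fam_sumE linear_sum.
    by apply: eq_bigr => i _; case: (rP i).
  by apply: memv_suml => i _; case: (rP i).
apply/directv_sum_independent => us usR us0.
pose act (i : F) := (val i \in flats 2 A) && (points A (val i) \in trips).
pose phi : {ffun F -> {ffun F -> dual V}} :=
  [ffun i => if act i then family_fun (us (points A (val i))) else 0].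
have phi0 : phi \in relS F 2 A.
  rewrite [relS _ _ _]/= memv_cap memv_ker fam_sumE; apply/andP; split; last first.
    apply/flat_sumP; split=> i; rewrite ffunE /act; last by move/negPf ->.
    move=> i2; rewrite i2 /=; case: ifP => [Lt|_]; last exact: mem0v.
    by apply/(relS1P (val i)); exists (us (points A (val i))) => //; apply: usR.
  have -> : \sum_i phi i = family_fun (\sum_(L in trips) us L).
    under eq_bigr => i _ do rewrite ffunE.
    rewrite -big_mkcond /= linear_sum /=.
    pose acts := [set i : F | act i].
    have -> : trips = [set points A (val i) | i in acts].
      apply/setP => L; apply/idP/imsetP => [Lt|[i]]; last first.
        by rewrite inE => /andP[_ Lt] ->.
      case/tripsP: (Lt) => a [b [ab LE _]]; have [XL XE _] := line_flat hA ab.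
      have X2 : (val a :&: val b)%VS \in flats 2 A by apply/(flats2P hA); exists a, b.
      by exists [` XL]%fset; rewrite ?inE /act /= ?X2 ?XE -LE.
    rewrite big_imset => [|i j _ _ ij]; last first.
      by apply/val_inj/(points_inj (valP i) (valP j)).
    by apply: eq_bigl => i; rewrite inE.
  by rewrite us0 linear0.
move=> L Lt; case/tripsP: (Lt) => a [b [ab LE _]].
have [XL XE _] := line_flat hA ab.
have X2 : (val a :&: val b)%VS \in flats 2 A by apply/(flats2P hA); exists a, b.
move: phi0; rewrite rel2 memv0 => /eqP/ffunP/(_ [` XL]%fset).
rewrite !ffunE /act /= X2 XE -LE Lt /= => e0; apply: family_inj.
by rewrite e0 linear0.
Qed.
End Decomposition.

(** * Modular chains *)
Section Supersolvable.
Variables (K : fieldType) (E : vectType K) (T : finType) (al : T -> E).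
Hypothesis als : simple al.
Hypothesis decomp : lines_decompose al.
Local Notation trips := (trips al).
Local Notation linked := (linked al).
Local Notation span := (spanned al).

(** The filtrations that define supersolvability, in terms of points. *)
Definition modular_chain (r : nat) (F : nat -> {set T}) : Prop :=
  [/\ F r = setT,
      forall i, (1 <= i < r)%N -> F i \subset F i.+1,
      forall i, (1 <= i <= r)%N -> \dim (span (F i)) = i
    & forall i, (2 <= i <= r)%N -> forall a b, a \in F i -> b \in F i ->
        a != b -> exists2 c, c \in F i.-1 & collinear al a b c].

Definition extending (S : {set T}) : pred {set T} :=
  fun L => [&& L \in trips, L :&: S != set0 & ~~ (L \subset S)].

(** Adds to S a line that meets S without lying in it, if there is one.  This
    raises the rank by at most 1 and encloses at least one more line. *)
Definition grow (S : {set T}) : {set T} :=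
  if [pick L | extending S L] is Some L then S :|: L else S.

Lemma grow_sub (S : {set T}) : S \subset grow S.
Proof. by rewrite /grow; case: pickP => // L _; apply: subsetUl. Qed.

(** The added line meets S, which provides the third point required of a modular
    chain for two of its points. *)
Lemma grow_coll (S : {set T}) a b : a \in grow S -> b \in grow S -> a != b ->
  exists2 c, c \in S & collinear al a b c.
Proof.
have inS x y : x \in S -> exists2 c, c \in S & collinear al x y c.
  by exists x => //; apply: coll_l.
rewrite /grow; case: pickP => [L|_] => [/and3P[Lt LS _]|aS _ _]; last exact: inS.
rewrite !inE => /orP[aS|aL]; first by move=> _ _; apply: inS.
case/orP=> [bS|bL] ab; first by have [c cS bac] := inS b a bS; exists c; rewrite // collC.
have /set0Pn[c] := LS; rewrite inE => /andP[cL cS]; exists c => //.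
by move: cL; rewrite (trip_line als Lt ab aL bL) inE.
Qed.

Lemma grow_dim (S : {set T}) : (\dim (span (grow S)) <= (\dim (span S)).+1)%N.
Proof.
rewrite /grow; case: pickP => [L /and3P[Lt /set0Pn[a] LS _]|_]; last exact: leqnSn.
move: LS; rewrite inE => /andP[aL aS]; have [b bL /andP[ba _]] := trip_third a a Lt.
have le : (span (S :|: L) <= span S + <[al b]>)%VS.
  rewrite spannedU subv_add addvSl (trip_line als Lt _ aL bL) 1?eq_sym //=.
  rewrite line_spanned 1?eq_sym // addvS //.
  by rewrite -memvE mem_spanned.
apply: leq_trans (dimvS le) _; apply: leq_trans (dimv_add_leqif _ _) _.
by rewrite dim_vline als.1 addn1.
Qed.

Hypothesis conn : forall s t, connect linked s t.

Lemma extending_exists (S : {set T}) : S != set0 -> S != setT ->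
  exists L, extending S L.
Proof.
case/set0Pn=> s sS ST; apply/existsP; apply: contraNT ST; rewrite negb_exists.
move=> /forallP none; apply/eqP/setP => t; rewrite inE.
have /connectP[p pth ->] := conn s t.
elim: p s sS pth => //= u p IH s sS /andP[/existsP[L /and3P[Lt sL uL]] pth].
apply: IH => //; have := none L; rewrite /extending Lt /=.
rewrite negb_and !negbK => /orP[/eqP L0|/subsetP]; last exact.
by have : s \in L :&: S; [rewrite inE sL | rewrite L0 inE].
Qed.

Definition inner (S : {set T}) : {set {set T}} := [set L in trips | L \subset S].

Lemma mem_inner S L : (L \in inner S) = (L \in trips) && (L \subset S).
Proof. by rewrite [LHS]inE. Qed.

Lemma grow_inner (S : {set T}) : S != set0 -> S != setT ->
  (#|inner S| < #|inner (grow S)|)%N.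
Proof.
move=> S0 ST; apply: proper_card; rewrite /grow; case: pickP => [L|none]; last first.
  by have [L] := extending_exists S0 ST; rewrite none.
case/and3P=> Lt _ LS; apply/properP; split.
  apply/subsetP => M; rewrite !mem_inner => /andP[-> MS] /=.
  exact: subset_trans MS (subsetUl _ _).
by exists L; rewrite !mem_inner Lt ?subsetUr //= (negPf LS).
Qed.

(** Starting from one point, r - 1 steps enclose all r - 1 lines, hence reach all
    points.  The rank then goes from 1 to r in r - 1 steps of at most 1, so that
    every step raises it by exactly 1. *)
Lemma grown_chain (s0 : T) : #|trips| = (\dim (span setT) - 1)%N ->
  exists F, modular_chain (\dim (span setT)) F.
Proof.
set r := \dim _ => tr; pose G k := iter k grow [set s0].
have r0 : (0 < r)%N.
  rewrite lt0n dimv_eq0; apply: contraTneq (mem_spanned al (in_setT s0)) => ->.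
  by rewrite memv0 als.1.
have G0 k : G k != set0.
  apply/set0Pn; exists s0; elim: k => [|k IH]; first by rewrite inE.
  exact: (subsetP (grow_sub _)).
have Gdim k : (\dim (span (G k)) <= k.+1)%N.
  elim: k => [|k IH]; first by rewrite /G /= /spanned big_set1 dim_vline leq_b1.
  by apply: (leq_trans (grow_dim _)); rewrite ltnS.
have GT k : (k.+1 < r)%N -> G k != setT.
  move=> kr; apply: contraTneq kr => GkT; rewrite -leqNgt /r -GkT; exact: Gdim.
have Gin k : (k < r)%N -> (k <= #|inner (G k)|)%N.
  elim: k => // k IH kr; apply: (leq_trans _ (grow_inner (G0 k) (GT k kr))).
  by rewrite ltnS; apply: IH; apply: ltnW.
have Glast : G r.-1 = setT.
  apply/eqP; apply/negPn/negP => nT; have [L] := extending_exists (G0 _) nT.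
  case/and3P=> Lt _ /negP; apply.
  have /eqP innerT : inner (G r.-1) == trips.
    rewrite eqEcard tr subn1 Gin ?prednK // andbT.
    by apply/subsetP => M; rewrite mem_inner => /andP[].
  by move: Lt; rewrite -innerT mem_inner => /andP[].
have Gge k j : (\dim (span (G (k + j))) <= \dim (span (G k)) + j)%N.
  elim: j => [|j IH]; first by rewrite !addn0.
  by rewrite !addnS; apply: leq_trans (grow_dim _) _; rewrite ltnS.
(* Chains are indexed from 1, the growth from 0. *)
exists (fun i => G i.-1); split=> //.
- by case=> // i _; apply: grow_sub.
- case=> // i ir; apply/eqP; rewrite eqn_leq Gdim /=.
  have ir' : (i <= r.-1)%N by rewrite -ltnS prednK.
  have le := Gge i (r.-1 - i)%N; rewrite subnKC // Glast -/r in le.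
  rewrite -(leq_add2r (r.-1 - i)); apply: leq_trans le.
  by rewrite addSn subnKC // prednK.
by case=> [//|[//|i]] _ a b aF bF ab; apply: grow_coll.
Qed.

Section Chain.
Variables (r : nat) (F : nat -> {set T}).
Hypothesis chain : modular_chain r F.
Hypothesis r_gt0 : (0 < r)%N.

Lemma chain_mono i j : (1 <= i)%N -> (i <= j <= r)%N -> F i \subset F j.
Proof.
have [_ Fs _ _] := chain; move=> i1 /andP[ij jr].
elim: j ij jr => [|j IH]; first by rewrite leqn0 => /eqP i0; rewrite i0 in i1.
rewrite leq_eqVlt => /orP[/eqP -> //|]; rewrite ltnS => ij jr.
apply: subset_trans (IH ij (ltnW jr)) (Fs j _).
by rewrite (leq_trans i1 ij).
Qed.

Lemma new_point j : (2 <= j <= r)%N ->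
  exists2 p, p \in F j & al p \notin span (F j.-1).
Proof.
have [_ _ Fd _] := chain; case: j => [//|j] /andP[j1 jr].
have : ~~ (span (F j.+1) <= span (F j))%VS.
  apply/negP => /dimvS; rewrite !Fd ?jr ?(ltnW jr) //= ?ltnn //.
  by rewrite andbT.
move=> ns; have [p /andP[pF pn]|none] :=
    pickP (fun p => (p \in F j.+1) && (al p \notin span (F j))).
  by exists p.
case/negP: ns; apply/spannedP => t tF; apply/negPn/negP => tn.
by have := none t; rewrite tF tn.
Qed.

(** Every term of the chain is a flat: together with a point p of full rank, a new
    point a in the span of the previous term would put p in that span, by the
    third point on the line through p and a. *)
Lemma chain_flat j a : (2 <= j <= r)%N -> a \in F j -> a \notin F j.-1 ->
  al a \notin span (F j.-1).
Proof.
have [_ _ _ Fc] := chain; move=> jr aF aN; apply/negP => as_.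
have [p pF pn] := new_point jr.
have ap : p != a by apply: contraNneq pn => ->.
have [c cF pac] := Fc j jr p a pF aF ap.
have ca : c != a by apply: contraNneq aN => <-.
have cp : c != p by apply: contraNneq pn => <-; apply: mem_spanned.
have [k [l [k0 l0 cE]]] := coll_coefs als cp ca pac.
case/negP: pn; rewrite -[al p](scalerK k0).
have -> : k *: al p = al c - l *: al a by rewrite cE addrK.
by rewrite memvZ // memvB ?memvZ // mem_spanned.
Qed.

Let new j : {set T} := F j :\: F j.-1.
(** Among the new points of a level one is distinguished; the relations on the
    lines from it to the other new points generate all relations. *)
Let pivot j : option T := [pick p in new j].

Lemma pivot_exists j : (2 <= j <= r)%N -> exists2 p, pivot j = Some p & p \in new j.
Proof.
move=> jr; rewrite /pivot; case: pickP => [p pn|none]; first by exists p.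
have [p pF pn] := new_point jr; have := none p; rewrite inE pF andbT.
by move/negbT; rewrite negbK => /(mem_spanned al) ps; rewrite ps in pn.
Qed.

Definition pivotal j : pred {set T} :=
  fun L => [exists p, exists h, [&& pivot j == Some p, h \in new j, h != p &
    L == line al p h]].

(** The line through the pivot and h meets the previous term in a third point,
    and the relation of these three points eliminates h. *)
Lemma pivotal_relation j p h : (2 <= j <= r)%N -> pivot j = Some p ->
  p \in new j -> h \in new j -> h != p ->
  line al p h \in trips /\ exists x : coefs K T,
    [/\ x \in relations al (line al p h), x h = 1 &
        forall t, t != h -> t != p -> t \notin F j.-1 -> x t = 0].
Proof.
have [_ _ _ Fc] := chain; move=> jr pj /setDP[pF pN] /setDP[hF hN] hp.
have ph : p != h by rewrite eq_sym.
have [c cF phc] := Fc j jr p h pF hF ph.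
have ch : c != h by apply: contraNneq hN => <-.
have cp : c != p by apply: contraNneq pN => <-.
split.
  apply/tripsP; exists p, h; split=> //.
  by rewrite (cardsD1 p) (cardsD1 h) (cardsD1 c) !inE coll_l coll_r phc hp ch cp.
have [k [l [k0 l0 cE]]] := coll_coefs als cp ch phc.
exists (delta K h + (- l^-1) *: delta K c + (l^-1 * k) *: delta K p); split.
- apply/relationsP; split=> [t tL|].
    have nt s : collinear al p h s -> (t == s) = false.
      by move=> sL; apply: contraNF tL => /eqP ->; rewrite inE.
    by rewrite !ffunE !nt ?coll_l ?coll_r // !scaler0 !addr0.
  rewrite !linearD !linearZ /= !comb_delta cE scalerDr !scalerA !mulNr mulVf //.
  by rewrite scaleN1r [X in al h + X]addrC addrA subrr add0r scaleNr addNr.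
- by rewrite !ffunE eqxx [h == c]eq_sym (negPf ch) (negPf hp) !scaler0 !addr0.
move=> t th tp tF; have tc : t != c by apply: contraNneq tF => ->.
by rewrite !ffunE (negPf th) (negPf tc) (negPf tp) !scaler0 !addr0.
Qed.

Definition level_line L : bool :=
  [exists i : 'I_(r - 1), pivotal i.+2 L].

(** Elimination of the new points of the highest level by pivotal relations; the
    pivot itself disappears because it is not in the span of the lower levels. *)
Lemma pivotal_generate j x : (1 <= j <= r)%N -> x \in relations al (F j) ->
  (x \in \sum_(L in trips | level_line L) relations al L)%VS.
Proof.
have [_ _ Fd _] := chain; elim: j x => [//|j IH] x /andP[_ jr] xr.
have [j0|j0] := posnP j.
  rewrite j0 in xr jr *; have F1 : (#|F 1%N| <= 1)%N.
    apply/card_le1P => a aF b; rewrite inE; apply/idP/eqP => [bF|-> //].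
    apply/eqP; apply/negPn/negP => ba.
    have : (plane al b a <= span (F 1%N))%VS.
      by rewrite subv_add -!memvE !mem_spanned.
    by move/dimvS; rewrite dim_plane // Fd.
  have d0 : \dim (relations al (F 1%N)) = 0%N.
    apply/eqP; rewrite -leqn0 -(leq_add2r 1) add0n.
    by have := dim_relations al (F 1%N); rewrite Fd // => ->.
  move/eqP: d0 xr; rewrite dimv_eq0 => /eqP ->.
  by rewrite memv0 => /eqP ->; rewrite mem0v.
have jr2 : (2 <= j.+1 <= r)%N by rewrite ltnS j0.
have [p pj pn] := pivot_exists jr2.
have x_ h : exists y : coefs K T, h \in new j.+1 -> h != p ->
    [/\ y \in relations al (line al p h), y h = 1 &
        forall t, t != h -> t != p -> t \notin F j -> y t = 0].
  have [hn|//] := boolP (h \in new j.+1); last by exists 0.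
  have [//|hp] := eqVneq h p; first by exists 0.
  by have [_ [y yP]] := pivotal_relation jr2 pj pn hn hp; exists y.
have [y yP] := fin_all_exists x_.
pose z := \sum_(h in new j.+1 | h != p) (x h : K) *: y h.
have zS : (z \in \sum_(L in trips | level_line L) relations al L)%VS.
  apply: memv_suml => h /andP[hn hp]; apply: memvZ.
  have [Lt _] := pivotal_relation jr2 pj pn hn hp.
  have ll : level_line (line al p h).
    have lt : (j.-1 < r - 1)%N by rewrite ltn_subRL add1n prednK.
    apply/existsP; exists (Ordinal lt); apply/existsP; exists p; apply/existsP; exists h.
    by rewrite /= prednK // pj eqxx hn hp eqxx.
  have [yr _ _] := yP h hn hp.
  apply: (subvP (sumv_sup (line al p h) _ (subvv _))) yr; by rewrite Lt ll.
rewrite -(subrK z x); apply: memvD => //; apply: IH.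
  by rewrite j0 ltnW.
have /relationsP[xF x0] := xr.
have w0 : comb al (x - z) = 0.
  rewrite linearB /= x0 sub0r /z linear_sum big1 ?oppr0 // => h /andP[hn hp].
  by have [/relationsP[_ y0] _ _] := yP h hn hp; rewrite linearZ /= y0 scaler0.
have jF : F j \subset F j.+1 by apply: chain_mono; rewrite ?leqnSn.
have wN t : t != p -> t \notin F j -> (x - z) t = 0.
  move=> tp tF; rewrite !ffunE sum_ffunE; have [tN|tN] := boolP (t \in new j.+1).
    rewrite (bigD1 t) ?tN //= ffunE; have [_ -> _] := yP t tN tp.
    rewrite big1 ?addr0 => [|h /andP[/andP[hn hp] ht]].
      by rewrite /GRing.scale /= mulr1 subrr.
    by have [_ _ yh] := yP h hn hp; rewrite ffunE yh ?scaler0 // eq_sym.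
  rewrite xF; last by apply: contra tN => tFj; rewrite inE tFj tF.
  rewrite big1 ?subr0 // => h /andP[hn hp].
  have [_ _ yh] := yP h hn hp; rewrite ffunE yh ?scaler0 //.
  by apply: contraNneq tN => ->.
apply/relationsP; split=> // t tF; have [->|tp] := eqVneq t p; last exact: wN.
apply/eqP; apply: contraT => wp; move: pn; rewrite inE => /andP[pN pF].
case/negP: (chain_flat jr2 pF pN); rewrite -[al p](scalerK wp).
move: w0; rewrite combE (bigD1 p) //= => /eqP; rewrite addr_eq0 => /eqP ->.
rewrite memvZ // memvN; apply: memv_suml => s sp.
have [sF|sF] := boolP (s \in F j); first by rewrite memvZ // mem_spanned.
by rewrite wN // scale0r mem0v.
Qed.

(** The lines are independent, so that a generating set of relations has to
    involve each of them. *)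
Lemma trip_level_line L : L \in trips -> level_line L.
Proof.
move=> Lt; apply: contraT => nL.
have R0 : relations al L = 0%VS.
  apply/eqP; rewrite -subv0; apply/subvP => x xL.
  have /directv_sumP/(_ L Lt) <- := decomp.2; rewrite memv_cap xL /=.
  have xF : x \in relations al (F r).
    have [-> _ _ _] := chain; have /relationsP[_ x0] := xL.
    by apply/relationsP; split=> // t; rewrite inE.
  have := pivotal_generate (j := r) _ xF; rewrite r_gt0 leqnn => /(_ isT).
  apply/subvP/subv_sumP => M /andP[Mt lM]; apply: (sumv_sup M) => //.
  by rewrite Mt; apply: contraNneq nL => <-.
have := dim_trip_relations als Lt; rewrite R0 dimv0 => /esym/eqP.
by rewrite subn_eq0 leqNgt (trip_card Lt).
Qed.

(** If h and h' were on different lines through the pivot, the line through h and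
    h' would have a third point in the previous term, hence be pivotal for some
    level.  Flatness of the chain excludes all levels but j, and at level j it
    would pass through the pivot. *)
Lemma pivotal_unique j L M : (2 <= j <= r)%N -> pivotal j L -> pivotal j M -> L = M.
Proof.
move=> jr /existsP[p /existsP[h /and4P[/eqP pj hn hp /eqP LE]]].
case/existsP=> p' /existsP[h' /and4P[]]; rewrite pj => /eqP[<-] h'n h'p /eqP ME.
have [hh|hh] := eqVneq h h'; first by rewrite LE ME hh.
have [_ _ _ Fc] := chain.
have pn : p \in new j.
  by move: (pivot_exists jr) => [q]; rewrite pj => -[<-].
have /setDP[hF hN] := hn; have /setDP[h'F h'N] := h'n; have /setDP[pF pN] := pn.
have [c cF hhc] := Fc j jr h h' hF h'F hh.
have ch : c != h by apply: contraNneq hN => <-.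
have ch' : c != h' by apply: contraNneq h'N => <-.
set Z := line al h h'; have Zt : Z \in trips.
  apply/tripsP; exists h, h'; split=> //.
  rewrite (cardsD1 h) (cardsD1 h') (cardsD1 c) !inE coll_l coll_r hhc.
  by rewrite [h' == h]eq_sym hh ch ch'.
have hZ : h \in Z by apply: line_l.
have h'Z : h' \in Z by apply: line_r.
have /existsP[i /existsP[q /existsP[g]]] := trip_level_line Zt.
case/and4P=> /eqP qi gn gq /eqP ZE.
have ir : (2 <= i.+2 <= r)%N by have := ltn_ord i; rewrite ltn_subRL add1n => ->.
have qn : q \in new i.+2.
  by move: (pivot_exists ir) => [q']; rewrite qi => -[<-].
have /setDP[gF gN] := gn; have /setDP[qF qN] := qn.
have qg : q != g by rewrite eq_sym.
have spZ : span Z = plane al q g by rewrite ZE line_spanned.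
have spZ' : span Z = plane al h h' by rewrite line_spanned.
case/andP: (jr) => j2 jr'; case/andP: (ir) => i2 ir'.
have [ij|ji|ij] := ltngtP i.+2 j.
- have sub : F i.+2 \subset F j.-1.
    apply: chain_mono => //; rewrite -ltnS prednK ?ij ?(leq_trans (leq_pred _)) //.
    exact: ltnW.
  have := chain_flat jr hF hN; case/negP; apply: (subvP (spannedS al sub)).
  apply: (subvP _ _ (mem_spanned al hZ)); rewrite spZ subv_add -!memvE.
  by rewrite !mem_spanned.
- have sub : F j \subset F i.+1.
    by apply: chain_mono; [apply: ltnW | rewrite -ltnS ji ltnW].
  have := chain_flat ir gF gN; case/negP; apply: (subvP (spannedS al sub)).
  have gZ : g \in Z by rewrite ZE line_r.
  apply: (subvP _ _ (mem_spanned al gZ)); rewrite spZ' subv_add -!memvE.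
  by rewrite !mem_spanned.
have pq : q = p by move: qi; rewrite ij pj => -[].
have pZ : p \in Z by rewrite ZE pq line_l.
have Lp : Z = L by rewrite LE (trip_line als Zt _ pZ hZ) // eq_sym.
by rewrite -Lp ME (trip_line als Zt _ pZ h'Z) // eq_sym.
Qed.

(** There is at most one line for each of the levels 2, ..., r. *)
Lemma chain_trips : (#|trips| <= r - 1)%N.
Proof.
have [r1|r1] := posnP (r - 1)%N.
  rewrite r1 leqn0 cards_eq0; apply/eqP/setP => L; rewrite [RHS]inE.
  apply/negP => /trip_level_line/existsP[i]; by have := ltn_ord i; rewrite {2}r1.
have lev_ (L : {set T}) : exists i : 'I_(r - 1), L \in trips -> pivotal i.+2 L.
  have [/trip_level_line/existsP[i]|//] := boolP (L \in trips); first by exists i.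
  by exists (Ordinal r1).
have [lev levP] := fin_all_exists lev_.
have inj : {in trips &, injective lev}.
  move=> L M Lt Mt LM; apply: (@pivotal_unique (lev L).+2); last 1 first.
  - by rewrite LM; apply: levP.
  - by have := ltn_ord (lev L); rewrite ltn_subRL add1n => ->.
  exact: levP.
by rewrite -(card_in_imset inj) -[X in (_ <= X)%N]card_ord max_card.
Qed.
End Chain.
End Supersolvable.

(** * Irreducibility as connectedness *)
Section Splitting.
Variables (K : fieldType) (V : vectType K) (A : {fset {vspace V}}).
Hypothesis hA : arrangement A.
Local Notation eqn := (equation hA).

Lemma limg_vsval (U : {vspace V}) : limg (linfun (@vsval _ _ U)) = U.
Proof.
apply/vspaceP => v; apply/memv_imgP/idP => [[u _ ->]|vU].
  by rewrite lfunE subvsP.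
by exists (vsproj U v); rewrite ?memvf // lfunE /= vsprojK.
Qed.

Definition trace (U H : {vspace V}) : {vspace subvs_of U} :=
  (linfun (@vsval _ _ U) @^-1: H)%VS.

Lemma traceK U H : (linfun (@vsval _ _ U) @: trace U H)%VS = (H :&: U)%VS.
Proof.
by rewrite /trace -lpreim_cap_limg limg_vsval lpreimK // limg_vsval capvSr.
Qed.

Lemma trace_arrangement (U W : {vspace V}) (B : {fset {vspace V}}) :
  (U + W = fullv)%VS -> (B `<=` A)%fset -> (forall H, H \in B -> W <= H)%VS ->
  arrangement [fset trace U H | H in B]%fset.
Proof.
move=> UW BA WB X /imfsetP[H /= HB ->].
have [a a0 HE] := hA (fsubsetP BA H HB).
exists (restrict_fun U a).
  apply: contraNneq a0 => a0.
  have : (fullv <= lker a)%VS.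
    rewrite -UW subv_add; apply/andP; split; last by rewrite -HE WB.
    apply/subvP => v vU; rewrite memv_ker.
    have := congr1 (fun g : dual (subvs_of U) => g (vsproj U v)) a0.
    by rewrite comp_lfunE lfunE /= vsprojK // zero_lfunE => ->.
  move=> /subvP ka; apply/eqP/lfunP => v; apply/eqP.
  by rewrite zero_lfunE -memv_ker ka ?memvf.
apply/vspaceP => u; rewrite memv_ker comp_lfunE -memv_ker -HE.
by rewrite /trace -memv_preim.
Qed.

(** An arrangement whose hyperplanes each contain one of two complementary
    nonzero subspaces is a product. *)
Lemma split_reducible (V1 V2 : {vspace V}) (B1 B2 : {fset {vspace V}}) :
  V1 != 0%VS -> V2 != 0%VS -> (V1 + V2)%VS = fullv -> (V1 :&: V2)%VS = 0%VS ->
  A = (B1 `|` B2)%fset -> (forall H, H \in B1 -> V2 <= H)%VS ->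
  (forall H, H \in B2 -> V1 <= H)%VS -> ~ irreducible A.
Proof.
move=> V10 V20 VV V0 AE H1 H2; apply.
exists V1, V2, [fset trace V1 H | H in B1]%fset, [fset trace V2 H | H in B2]%fset.
have B1A : (B1 `<=` A)%fset by rewrite AE fsubsetUl.
have B2A : (B2 `<=` A)%fset by rewrite AE fsubsetUr.
split=> //.
- exact: trace_arrangement VV B1A H1.
- by apply: trace_arrangement B2A H2; rewrite addvC.
rewrite {1}AE /product_arrangement; congr (_ `|` _)%fset.
  apply/fsetP => H; apply/idP/imfsetP => [HB|[X /= /imfsetP[G /= GB ->] ->]].
    exists (trace V1 H); first by apply/imfsetP; exists H.
    by rewrite traceK vspace_modr ?H1 // VV capvf.
  by rewrite traceK vspace_modr ?H1 // VV capvf.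
apply/fsetP => H; apply/idP/imfsetP => [HB|[X /= /imfsetP[G /= GB ->] ->]].
  exists (trace V2 H); first by apply/imfsetP; exists H.
  by rewrite traceK addvC vspace_modr ?H2 // [(V2 + V1)%VS]addvC VV capvf.
by rewrite traceK addvC vspace_modr ?H2 // [(V2 + V1)%VS]addvC VV capvf.
Qed.

Hypothesis irr : irreducible A.

Lemma irreducible_essential : (0 < rank A)%N -> center A = 0%VS.
Proof.
move=> r0; apply/eqP; apply: contraT => c0; exfalso.
have c0' : ((center A)^C)%VS != 0%VS by rewrite -dimv_eq0 dimv_compl -lt0n.
apply: (@split_reducible (center A) ((center A)^C)%VS fset0 A) => //.
- exact: addv_complf.
- exact: capv_compl.
- by rewrite fset0U.
by move=> H HA; apply: center_le.
Qed.

Definition hyperplanes (S : {set A}) : {fset {vspace V}} := [fset val H | H in S]%fset.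

Lemma hyperplanes_sub S : (hyperplanes S `<=` A)%fset.
Proof. by apply/fsubsetP => H /imfsetP[G _ ->]; apply: valP. Qed.

Lemma mem_hyperplanes (S : {set A}) (H : A) : (val H \in hyperplanes S) = (H \in S).
Proof. by rewrite mem_imfset //; apply: val_inj. Qed.

Lemma hyperplanesE (S : {set A}) : [set H : A | val H \in hyperplanes S] = S.
Proof. by apply/setP => H; rewrite inE mem_hyperplanes. Qed.

(** If every line lies on one side of a partition of the points, so do the
    relations, and the ranks of the two sides add up to at most the total
    rank. *)
Lemma relations_split (S : {set A}) :
  (lker (comb eqn) <= \sum_(L in trips eqn) relations eqn L)%VS ->
  (forall L, L \in trips eqn -> (L \subset S) || (L \subset ~: S)) ->
  (#|S| + #|~: S| <=
   \dim (relations eqn S) + \dim (relations eqn (~: S)) + \dim (spanned eqn setT))%N.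
Proof.
move=> gen split_.
have le : (lker (comb eqn) <= relations eqn S + relations eqn (~: S))%VS.
  apply: subv_trans gen _; apply/subv_sumP => L /split_/orP[] /subsetP sub.
    apply: subv_trans (addvSl _ _); apply/subvP => x /relationsP[xL x0].
    by apply/relationsP; split=> // t tS; apply: xL; apply: contra tS; apply: sub.
  apply: subv_trans (addvSr _ _); apply/subvP => x /relationsP[xL x0].
  by apply/relationsP; split=> // t tS; apply: xL; apply: contra tS; apply: sub.
rewrite cardsC -(dim_coefs K) -(limg_ker_dim (comb eqn) fullv) capfv -spanned_setT.
rewrite leq_add2r; apply: leq_trans (dimvS le) _; exact: dimv_add_leqif.
Qed.

(** Otherwise the points connected to s and the remaining ones span independent
    subspaces of V^*, and the two centers decompose V. *)
Lemma irreducible_connected : lines_decompose eqn -> (0 < rank A)%N ->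
  forall s t, connect (linked eqn) s t.
Proof.
move=> decomp r0 s t; apply: contraT => nst; exfalso.
have c0 := irreducible_essential r0.
pose S := [set x | connect (linked eqn) s x].
have splitS L : L \in trips eqn -> (L \subset S) || (L \subset ~: S).
  move=> Lt; have [/eqP|[a]] := set_0Vmem (L :&: S).
    by rewrite setI_eq0 disjoints_subset => ->; rewrite orbT.
  rewrite !inE => /andP[aL sa]; apply/orP; left; apply/subsetP => b bL.
  rewrite inE; apply: connect_trans sa _; apply/connect1/existsP.
  by exists L; rewrite Lt aL bL.
have := relations_split decomp.1 splitS.
have sS : s \in S by rewrite inE connect0.
have tS : t \in ~: S by rewrite !inE.
rewrite -(dim_relations eqn S) -(dim_relations eqn (~: S)) addnACA leq_add2l => dle.
have cS S' : codim (center (hyperplanes S')) = \dim (spanned eqn S').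
  by rewrite (codim_center hA) ?hyperplanes_sub // hyperplanesE.
have AE : A = (hyperplanes S `|` hyperplanes (~: S))%fset.
  apply/fsetP => H; rewrite in_fsetU; apply/idP/orP => [HA|]; last first.
    by case=> /(fsubsetP (hyperplanes_sub _)).
  rewrite -[H]/(val [` HA]%fset) !mem_hyperplanes in_setC.
  by case: (_ \in S); [left | right].
have V0 : (center (hyperplanes (~: S)) :&: center (hyperplanes S))%VS = 0%VS.
  apply/eqP; rewrite -subv0 -c0; apply/sub_centerP => H; rewrite {1}AE in_fsetU.
  case/orP=> HB; apply: subv_trans (center_le HB).
    exact: capvSr.
  exact: capvSl.
have dT : \dim (spanned eqn setT) = \dim {:V}.
  by rewrite -(rankE hA) /rank c0 /codim dimv0 subn0.
have dle' S' : (\dim (center (hyperplanes S')) + \dim (spanned eqn S'))%N = \dim {:V}.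
  by rewrite -cS /codim subnKC ?dimvS ?subvf.
have pos (S' : {set A}) x : x \in S' -> (0 < \dim (spanned eqn S'))%N.
  move=> xS; rewrite lt0n dimv_eq0; apply: contraTneq (mem_spanned eqn xS) => ->.
  by rewrite memv0 equation_neq0.
have dS := dle' S; have dC := dle' (~: S).
have pS := pos S s sS; have pC := pos _ t tS.
apply: (@split_reducible (center (hyperplanes (~: S))) (center (hyperplanes S))
    (hyperplanes S) (hyperplanes (~: S))) => //.
- by rewrite -dimv_eq0; lia.
- by rewrite -dimv_eq0; lia.
- by apply/eqP; rewrite eqEdim subvf dimv_disjoint_sum //=; lia.
- move=> H HB; exact: center_le.
- move=> H HB; exact: center_le.
Qed.
End Splitting.

(** * Freeness and supersolvability in terms of lines *)
Section FreeAcyclic.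
Variables (K : fieldType) (V : vectType K) (A : {fset {vspace V}}).
Hypothesis hA : arrangement A.
Local Notation eqn := (equation hA).

Lemma log_derivationE theta : log_derivation A theta <-> logarithmic eqn theta.
Proof.
split=> -[dth lth]; split=> //.
  by move=> t; apply: lth; rewrite lker_equation; apply: valP.
move=> a aA.
have : lker (eqn [` aA]%fset) = lker a by rewrite lker_equation.
move=> E; have : a \in <[eqn [` aA]%fset]>%VS by rewrite -sub_lker E.
case/vlineP => k ->; have [q qE] := lth [` aA]%fset; exists q.
have -> : linear_form (k *: eqn [` aA]%fset) = k *: linear_form (eqn [` aA]%fset).
  exact: linearZ.
have th0 : theta 0 = 0.
  by rewrite -[X in theta X](addNr 0) -scaleN1r dth.1 scaleN1r addNr.
by rewrite -[X in theta X]addr0 dth.1 th0 addr0 qE scalerAr.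
Qed.

Lemma free_arrangementE : free_arrangement A <-> log_free eqn.
Proof.
split=> -[m [b [lb gen]]]; exists m, b; split.
- by move=> i; apply/log_derivationE.
- by move=> theta /log_derivationE; apply: gen.
- by move=> i; apply/log_derivationE.
- by move=> theta /log_derivationE; apply: gen.
Qed.

(** Acyclicity is a property of the lattice, so that this makes freeness one. *)
Lemma free_iff_acyclic : TF2 A -> free_arrangement A <-> acyclic K (collinear eqn).
Proof.
move=> tf; have dec := TF2_decompose hA tf; have als := equation_simple hA.
split=> [/free_arrangementE fr|ac]; first exact: free_acyclic als dec fr.
by apply/free_arrangementE/(acyclic_log_free als dec).
Qed.

Lemma collE (a b c : A) : collinear eqn a b c = (val a :&: val b <= val c)%VS.
Proof.
have := bigcap_ker_sub [:: eqn a; eqn b] (eqn c).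
by rewrite !big_cons !big_nil capvf addv0 !lker_equation.
Qed.

Lemma meet_lattice (a b : A) : (val a :&: val b)%VS \in lattice A.
Proof. by rewrite -center_pair; apply/center_lattice/pair_sub. Qed.

(** Collinearity is expressed through lower bounds, as the intersection of two
    hyperplanes is a flat. *)
Lemma coll_lattice (a b c : A) : collinear eqn a b c <->
  forall Z : lattice A, (val Z <= val a)%VS -> (val Z <= val b)%VS -> (val Z <= val c)%VS.
Proof.
rewrite collE; split=> [abc Z Za Zb|/(_ [` meet_lattice a b]%fset)].
  by apply: subv_trans abc; rewrite subv_cap Za.
by apply; rewrite ?capvSl ?capvSr.
Qed.

(** Hyperplanes are recognized in the lattice by order alone: below V, with nothing
    between. *)
Lemma hyperplane_atom (X : lattice A) : val X \in A <->
  ~ (forall Z : lattice A, (val Z <= val X)%VS) /\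
  forall Y : lattice A, (val X <= val Y)%VS ->
    (val Y <= val X)%VS \/ forall Z : lattice A, (val Z <= val Y)%VS.
Proof.
have topL : fullv \in lattice A.
  have -> : fullv = center (fset0 : {fset {vspace V}}) by rewrite /center big_seq_fset0.
  exact/center_lattice/fsub0set.
have nonempty (Y : lattice A) : localization A (val Y) = fset0 -> val Y = fullv.
  move=> Y0; have := valP Y => /latticeP; rewrite Y0 => ->.
  by rewrite /center big_seq_fset0.
have not_top (H : A) : ~ (fullv <= val H)%VS.
  move=> top; have := dim_lker (eqn H); have := dimvS top.
  rewrite equation_neq0 lker_equation; lia.
split=> [XA|[nX atX]].
  split=> [/(_ [` topL]%fset)|Y XY]; first exact: (not_top [` XA]%fset).
  have [Y0|[G]] := fset_0Vmem (localization A (val Y)).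
    by right=> Z; rewrite (nonempty Y Y0) subvf.
  rewrite mem_localization => /andP[GA YG]; left.
  have := hyperplane_sub hA (H := [` XA]%fset) (H' := [` GA]%fset) (subv_trans XY YG).
  by move=> /(congr1 val) /= ->.
have [X0|[G]] := fset_0Vmem (localization A (val X)).
  by case: nX => Z; rewrite (nonempty X X0) subvf.
rewrite mem_localization => /andP[GA XG].
have GL := hyperplane_lattice hA [` GA]%fset.
case: (atX [` GL]%fset XG) => [GX|/(_ [` topL]%fset)]; last first.
  by move/(not_top [` GA]%fset).
by have -> : val X = G by apply/eqP; rewrite eqEsubv XG.
Qed.
End FreeAcyclic.

Lemma isomorphic_lattices_sym (K : fieldType) (V V' : vectType K)
    (A : {fset {vspace V}}) (A' : {fset {vspace V'}}) :
  isomorphic_lattices A A' -> isomorphic_lattices A' A.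
Proof.
case=> f [[g fK gK] mono]; exists g; split; first by exists f.
by move=> X Y; rewrite mono !gK.
Qed.

Lemma acyclic_isomorphic (K : fieldType) (V V' : vectType K)
    (A : {fset {vspace V}}) (A' : {fset {vspace V'}})
    (hA : arrangement A) (hA' : arrangement A') :
  isomorphic_lattices A A' ->
  acyclic K (collinear (equation hA')) -> acyclic K (collinear (equation hA)).
Proof.
case=> f [[g fK gK] mono] acyc.
have phi_ (H : A) : exists H' : A', val H' = val (f [` hyperplane_lattice hA H]%fset).
  set X := [` _]%fset.
  have /(hyperplane_atom hA)[nX atX] : val X \in A by exact: (valP H).
  suff XA : val (f X) \in A' by exists [` XA]%fset.
  apply/(hyperplane_atom hA'); split=> [top|Y].
    by apply: nX => Z; rewrite mono.
  rewrite -{1}[Y]gK -mono => /atX[YX|top]; [left|right=> Z].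
    by rewrite -[Y]gK -mono.
  by rewrite -[Y]gK -[Z]gK -mono.
have [phi phiE] := fin_all_exists phi_.
have phi_inj : injective phi.
  move=> H G E; have := phiE H; rewrite E phiE => /val_inj/(can_inj fK) GH.
  by apply/val_inj; have := congr1 val GH.
have collK a b c : collinear (equation hA') (phi a) (phi b) (phi c) =
    collinear (equation hA) a b c.
  apply/idP/idP => /coll_lattice lat; apply/coll_lattice => Z Za Zb.
    have := lat (f Z); rewrite !phiE -!mono; exact.
  by move: Za Zb; rewrite -[Z]gK !phiE -!mono; apply: lat.
move=> a b h ab abh; have [||u uP] := acyc (phi a) (phi b) (phi h).
- by rewrite (inj_eq phi_inj).
- by rewrite collK.
exists (fun t => u (phi t)) => s t w st ws wt stw.
have := uP (phi s) (phi t) (phi w); rewrite !(inj_eq phi_inj) !collK.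
exact.
Qed.

Section SupersolvableArrangement.
Variables (K : fieldType) (V : vectType K) (A : {fset {vspace V}}).
Hypothesis hA : arrangement A.
Local Notation eqn := (equation hA).

Lemma supersolvable_chain F : modular_chain eqn (rank A) F -> supersolvable A.
Proof.
case=> Fr Fs Fd Fc; exists (fun i => hyperplanes (F i)); split.
- rewrite Fr; apply/fsetP => H; apply/idP/idP => [/(fsubsetP (hyperplanes_sub _)) //|HA].
  by rewrite -[H]/(val [` HA]%fset) mem_hyperplanes inE.
- move=> i ir; apply/fsubsetP => _ /imfsetP[H /= HF ->].
  by rewrite mem_hyperplanes (subsetP (Fs i ir)).
- move=> i ir; rewrite /rank (codim_center hA) ?hyperplanes_sub // hyperplanesE.
  exact: Fd.
move=> i ir _ _ /imfsetP[H /= HF ->] /imfsetP[G /= GF ->] HG.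
have HG' : H != G by apply: contraNneq HG => ->.
have [c cF HGc] := Fc i ir H G HF GF HG'.
by exists (val c); rewrite ?mem_hyperplanes // -(collE hA).
Qed.

Lemma chain_supersolvable : supersolvable A ->
  exists F, modular_chain eqn (rank A) F.
Proof.
case=> F [Fr Fs Fd Fc].
have FA i : (1 <= i <= rank A)%N -> (F i `<=` A)%fset.
  case/andP=> i1 ir; rewrite -(subKn ir).
  have : (rank A - i < rank A)%N by rewrite ltn_subrL i1 (leq_trans i1 ir).
  elim: (rank A - i)%N => [|k IH] kr; first by rewrite subn0 Fr fsubset_refl.
  apply: fsubset_trans (IH (ltnW kr)).
  have := Fs (rank A - k.+1)%N; rewrite subnSK ?(ltnW kr) //; apply.
  by rewrite subn_gt0 kr leq_subr.
exists (fun i => [set H : A | val H \in F i]); split.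
- by apply/setP => H; rewrite !inE Fr (valP H).
- move=> i ir; apply/subsetP => H; rewrite !inE.
  exact: (fsubsetP (Fs i ir)).
- by move=> i ir; rewrite -(codim_center hA) ?FA //; apply: Fd.
move=> i ir a b; rewrite !inE => aF bF ab.
have [|c cF abc] := Fc i ir (val a) (val b) aF bF; first by rewrite (inj_eq val_inj).
have cA : c \in A.
  apply: (fsubsetP (FA i.-1 _)) cF; case: i ir {aF bF} => [//|i] /andP[i1 ir].
  by rewrite -ltnS i1 ltnW.
by exists [` cA]%fset; rewrite ?inE // collE.
Qed.
End SupersolvableArrangement.

Theorem proposition6p1 (K : fieldType) :
  (forall (V : vectType K) (A : {fset {vspace V}}),
     arrangement A -> irreducible A -> TF2 A -> (3 <= rank A)%N ->
     [/\ (#|` A|)%:Z =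
           (rank A)%:Z - (#|` triple_flats A|)%:Z
           + \sum_(X <- triple_flats A) ((#|` localization A X|)%:Z - 1),
         (#|` A| <= 1 + \sum_(X <- triple_flats A)
                          (#|` localization A X| - 1))%N,
         (rank A - 1 <= #|` triple_flats A|)%N
       & [<-> free_arrangement A;
              #|` A| = (1 + \sum_(X <- triple_flats A)
                              (#|` localization A X| - 1))%N;
              #|` triple_flats A| = (rank A - 1)%N;
              supersolvable A]]) /\
  (forall (V V' : vectType K)
          (A : {fset {vspace V}}) (A' : {fset {vspace V'}}),
     arrangement A -> arrangement A' -> TF2 A -> TF2 A' ->
     isomorphic_lattices A A' ->
     (free_arrangement A <-> free_arrangement A')).
Proof.
split=> [V A hA irr tf r3 | V V' A A' hA hA' tf tf' iso]; last first.
  rewrite (free_iff_acyclic hA tf) (free_iff_acyclic hA' tf').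
  by split; apply: acyclic_isomorphic => //; apply: isomorphic_lattices_sym.
have als := equation_simple hA; have dec := TF2_decompose hA tf.
have r0 : (0 < rank A)%N by apply: leq_trans r3.
have conn := irreducible_connected irr dec r0.
have [s0 _] : exists s : A, s \in [set: A].
  apply/set0Pn; apply: contraTneq r0 => A0.
  by rewrite (rankE hA) A0 /spanned big_set0 dimv0.
set trips := trips (equation hA).
have cardA := card_points als dec; rewrite -(rankE hA) -/trips in cardA.
have sumE : (\sum_(X <- triple_flats A) (#|` localization A X| - 1))%N
          = (\sum_(L in trips) (#|L| - 1))%N.
  exact: (sum_trips hA addn (fun m => m - 1)%N).
have sumB : (\sum_(L in trips) (#|L| - 1))%N
          = (\sum_(L in trips) (#|L| - 2) + #|trips|)%N.
  rewrite -sum1_card -big_split /=; apply: eq_bigr => L Lt.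
  by move: (trip_card Lt); case: #|L| => [|[|m]] //= _; rewrite !subSS !subn0 addn1.
have le := card_points_le conn s0; rewrite -/trips in le.
have acyc := acyclic_card als conn s0; rewrite -/trips in acyc.
rewrite sumE (card_trips hA) -/trips (card_arrangement A).
have ge : (rank A - 1 <= #|trips|)%N by lia.
split=> //.
  rewrite (sum_trips hA +%R (fun m => m%:Z - 1)) -/trips cardA.
  rewrite (eq_bigr (fun L : {set A} => (#|L| - 2)%N%:Z + 1)); last first.
    by move=> L Lt; move: (trip_card Lt); move: #|L| => m m2; lia.
  rewrite big_split /= -(big_morph Posz PoszD (erefl 0%:Z)) sumr_const.
  rewrite -[1 *+ _]/(_%:R) natz PoszD; ring.
have count2 : #|{: A}| = (1 + \sum_(L in trips) (#|L| - 1))%N <->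
    #|trips| = (rank A - 1)%N.
  by rewrite cardA sumB; move: #|trips| (rank A) r0 => t r r_gt0; split; lia.
tfae.
- by move/(free_iff_acyclic hA tf)/acyc.
- by move/count2.
- rewrite {1}(rankE hA) => /(grown_chain als conn s0)[F].
  by rewrite -(rankE hA); apply: supersolvable_chain.
move/(chain_supersolvable hA) => [F FP].
apply/(free_iff_acyclic hA tf)/acyc/count2/eqP; rewrite eqn_leq ge andbT.
by have := chain_trips als dec FP r0.
Qed.
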